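(* Let $\beta>0$ and $V=0$ (so that $\mu_\beta^0=\frac{dx}{2\pi}$). For every $\psi\in\mathsf H$, $$\sigma_\beta^0(\psi)^2=2\sum_{k=1}^\infty\frac1{1+\beta/k}\,|\hat\psi_k|^2 .$$
   Context: $\mathbb T=[-\pi,\pi]\simeq\mathbb R/2\pi\mathbb Z$, $\hat\psi_k=\int_{\mathbb T}\psi(x)e^{-ikx}\frac{dx}{2\pi}$. For $V=0$ the equilibrium measure is the uniform measure $\frac{dx}{2\pi}$, with density $\frac1{2\pi}$. The Hilbert transform is $H\psi(x)=-\mathrm{p.v.}\int_{\mathbb T}\frac{\psi(t)}{\tan(\frac{x-t}2)}\frac{dt}{2\pi}$, and, for $V=0$, the operator $\mathscr L$ is $-\mathscr L\phi=\phi''+\beta H(\phi')$, considered as a positive operator on the Hilbert space $\mathsf H=\{\psi\in L^2(\mathbb T):\psi'\in L^2(\mathbb T),\ \int_{\mathbb T}\psi\,\frac{dx}{2\pi}=0\}$ of real-valued functions with inner product $\langle\phi,\psi\rangle_{\mathsf H}=\int_{\mathbb T}\phi'\psi'\frac{dx}{2\pi}$; $\mathscr L^{-1}$ is its inverse on $\mathsf H$. The variance is $\sigma_\beta^0(\psi)^2:=\langle\psi,\mathscr L^{-1}\psi\rangle_{\mathsf H}$. *)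

(* Defs.v *)
From HB Require Import structures.
From mathcomp Require Import all_boot all_order all_algebra.
From mathcomp Require Import all_classical all_reals all_analysis.
From mathcomp.real_closed Require Import complex.

Set Implicit Arguments.
Unset Strict Implicit.
Unset Printing Implicit Defensive.

Import Order.TTheory GRing.Theory Num.Theory.
Import numFieldNormedType.Exports.

Local Open Scope classical_set_scope.
Local Open Scope ring_scope.

(* Functions on the circle are represented by 2 pi-periodic functions on the
   whole line, and elements of L^2 by representatives of their class modulo
   almost everywhere equality. *)

Section Circle.
Context {R : realType}.
Implicit Types (f g psi phi : R -> R) (beta : R).

Local Notation mu := (@lebesgue_measure R).
Local Notation circle := `[- (pi : R), pi]%classic.

Definition mean f : R := (\int[mu]_(x in circle) f x) / (2 * pi).

Definition meanC (f : R -> R[i]) : R[i] :=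
  (mean (fun x => complex.Re (f x)) +i* mean (fun x => complex.Im (f x)))%C.

Definition expi (t : R) : R[i] := (cos t +i* sin t)%C.

Definition fourier_coef psi (k : int) : R[i] :=
  meanC (fun x => (psi x)%:C%C * expi (- (k%:~R * x))).

Definition L2 f : Prop :=
  [/\ periodic f (2 * pi), measurable_fun setT f
    & mu.-integrable circle (fun x => ((f x) ^+ 2)%:E)].

Definition test_function f : Prop :=
  periodic f (2 * pi) /\ forall (n : nat) (x : R), derivable (derive1n n f) x 1.

Definition is_weak_derivative f g : Prop :=
  forall chi, test_function chi ->
    mean (fun x => f x * derive1 chi x) = - mean (fun x => g x * chi x).

Definition H1 f : Prop := L2 f /\ exists g, L2 g /\ is_weak_derivative f g.

(* Determined almost everywhere when [H1 f]; the zero function otherwise. *)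
Definition wderiv f : R -> R :=
  xget (fun=> 0) [set g | L2 g /\ is_weak_derivative f g].

Definition Hspace f : Prop := H1 f /\ mean f = 0.

Definition Hdot f g : R := mean (fun x => wderiv f x * wderiv g x).

(* By periodicity the truncated integral over the circle may be taken over the
   period [x - pi, x + pi] centred at the singularity. *)
Definition hilbert_trunc f (x eps : R) : R :=
  (\int[mu]_(t in (`[x - pi, x - eps] `|` `[x + eps, x + pi])%classic)
      (f t / tan ((x - t) / 2))) / (2 * pi).

Definition hilbert f (x : R) : R :=
  - lim (hilbert_trunc f x eps @[eps --> 0^'+]).

Definition Lop beta phi (x : R) : R :=
  - (wderiv (wderiv phi) x + beta * hilbert (wderiv phi) x).

(* The maximal domain of [Lop beta] as an unbounded operator on [Hspace]. *)
Definition Ldom beta phi : Prop :=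
  [/\ Hspace phi, H1 (wderiv phi)
    & exists2 psi, Hspace psi & ae_eq mu setT (Lop beta phi) psi].

(* The inverse of the operator on [Hspace]; its value is the preimage of [psi],
   up to almost everywhere equality, and the zero function if there is none. *)
Definition Linv beta psi : R -> R :=
  xget (fun=> 0) [set phi | Ldom beta phi /\ ae_eq mu setT (Lop beta phi) psi].

(* This is already the square sigma_beta^0(psi)^2, for the potential V = 0. *)
Definition sigma2 beta psi : R := Hdot psi (Linv beta psi).

End Circle.

(* Main.v *)
Require Import Defs.
From HB Require Import structures.
From mathcomp Require Import all_boot all_order all_algebra.
From mathcomp Require Import all_classical all_reals all_analysis.
From mathcomp Require Import measurable_realfun.
From mathcomp.real_closed Require Import complex.
From mathcomp Require Import ring lra.

Set Implicit Arguments.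
Unset Strict Implicit.
Unset Printing Implicit Defensive.

Import Order.TTheory GRing.Theory Num.Theory.
Import numFieldNormedType.Exports.

Local Open Scope classical_set_scope.
Local Open Scope ring_scope.

(** On the mode of frequency [n >= 1] the operator is multiplication by
    [n ^ 2 + beta * n], because the Hilbert transform turns [cos (n x)] into
    [- sin (n x)] and [sin (n x)] into [cos (n x)].  Hence the inverse divides
    the mode by [n * (n + beta)], the inner product multiplies it by [n ^ 2],
    and the sum over modes of [n ^ 2 / (n * (n + beta)) = 1 / (1 + beta / n)]
    times [|psi_n| ^ 2] is the formula; the factor 2 accounts for the negative
    frequencies of a real function.

    Making this rigorous means passing between functions and coefficients for
    derivatives that are only weak and for a Hilbert transform that is a
    pointwise principal value.  Three facts carry the passage.

    Uniqueness ([trig_coef_unique]): an integrable periodic function is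
    determined almost everywhere by its coefficients.  Testing against
    trigonometric polynomials that converge boundedly to the indicator of an
    arc shows that a function whose coefficients vanish has zero integral over
    every arc, and Lebesgue differentiation concludes.

    Absolute convergence ([coef_weak_summable]): if [f] has a square-integrable
    weak derivative [g], its coefficients are those of [g] divided by the
    frequency, so Bessel's inequality for [g] and the arithmetic-geometric mean
    inequality make the coefficients of [f] absolutely summable, even after
    multiplication by harmonic numbers.  With uniqueness, [f] is almost
    everywhere the sum of its Fourier series, and every pairing with [f] may be
    computed termwise ([parseval]).

    The Hilbert transform ([hilbert_trig_sum]): the truncated transform of a
    mode is, up to sign, the conjugate mode times a factor that tends to 1 as
    the truncation radius tends to 0 and is bounded by a multiple of a harmonic
    number.  The weighted summability above is what Tannery's theorem needs to
    pass to the limit in the series, at every point.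

    Consequently the coefficients of [Lop beta phi] are explicit for every
    [phi] in the domain ([Lop_spectrum]).  Dividing the coefficients of [psi]
    gives a solution whose second derivative still has an absolutely convergent
    series ([Lop_surjective]), so that [Linv beta psi] is a genuine preimage;
    whichever preimage it is, its coefficients are forced, and the termwise
    formula for the inner product gives the result ([cvg_sigma2]). *)

(** * Integrals over the circle *)

Section CircleIntegrals.
Context {R : realType}.
Implicit Types (f g h : R -> R) (D : set R).
Local Notation mu := (@lebesgue_measure R).
Local Notation circle := `[- (pi : R), pi]%classic.

Definition integrable_on D f : Prop := mu.-integrable D (EFin \o f).

Lemma integrable_on_bounded D f : measurable D -> (mu D < +oo)%E ->
  measurable_fun D f -> forall M, (forall x, D x -> `|f x| <= M) -> integrable_on D f.
Proof.
move=> mD fD mf M fM; apply: measurable_bounded_integrable => //.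
exists M; split; first exact: num_real.
by move=> y My x Dx; apply: (le_trans (fM _ Dx)); exact: ltW.
Qed.

Lemma integrable_on_mul D f h M : measurable D -> integrable_on D f ->
  measurable_fun D h -> (forall x, D x -> `|h x| <= M) ->
  integrable_on D (fun x => f x * h x).
Proof.
move=> mD If mh hM.
have := @integrableMl _ _ _ mu D mD _ _ If mh; apply.
exists M; split; first exact: num_real.
by move=> y My x Dx; apply: (le_trans (hM _ Dx)); exact: ltW.
Qed.

Lemma integrable_on_add D f g : measurable D -> integrable_on D f -> integrable_on D g ->
  integrable_on D (fun x => f x + g x).
Proof.
move=> mD If Ig; rewrite /integrable_on.
have := @integrableD _ _ _ mu D mD _ _ If Ig.
by apply: eq_integrable.
Qed.

Lemma integrable_on_sub D f g : measurable D -> integrable_on D f -> integrable_on D g ->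
  integrable_on D (fun x => f x - g x).
Proof.
move=> mD If Ig; rewrite /integrable_on.
have := @integrableB _ _ _ mu D mD _ _ If Ig.
by apply: eq_integrable.
Qed.

Lemma integrable_on_scale D f c : measurable D -> integrable_on D f ->
  integrable_on D (fun x => c * f x).
Proof.
move=> mD If; rewrite /integrable_on.
have := @integrableZl _ _ _ mu D mD c _ If.
by apply: eq_integrable.
Qed.

Lemma integrable_on_norm D f : measurable D -> integrable_on D f ->
  integrable_on D (fun x => `|f x|).
Proof.
move=> mD If; rewrite /integrable_on; have := integrable_abse If.
by apply: eq_integrable.
Qed.

Lemma integrable_on_cont f a b : continuous f -> integrable_on `[a, b] f.
Proof.
move=> cf; apply: continuous_compact_integrable; first exact: segment_compact.
exact: continuous_subspaceT.
Qed.

Lemma mean_add f g : integrable_on circle f -> integrable_on circle g ->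
  mean (fun x => f x + g x) = mean f + mean g.
Proof. by move=> If Ig; rewrite /mean RintegralD// mulrDl. Qed.

Lemma mean_sub f g : integrable_on circle f -> integrable_on circle g ->
  mean (fun x => f x - g x) = mean f - mean g.
Proof. by move=> If Ig; rewrite /mean RintegralB// mulrBl. Qed.

Lemma mean_scale c f : integrable_on circle f -> mean (fun x => c * f x) = c * mean f.
Proof. by move=> If; rewrite /mean RintegralZl// mulrA. Qed.

Lemma measurable_on_integrable D f : integrable_on D f -> measurable_fun D f.
Proof. by move=> /integrableP[/measurable_EFinP]. Qed.

Lemma Rintegral_ae_eq D f g : measurable D -> measurable_fun D f -> measurable_fun D g ->
  ae_eq mu D f g -> \int[mu]_(x in D) f x = \int[mu]_(x in D) g x.
Proof.
move=> mD mf mg fg; rewrite /Rintegral; congr fine.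
apply: ae_eq_integral => //; try exact/measurable_EFinP.
by apply: filterS fg => x /= fg /fg ->.
Qed.

Lemma mean_ae_eq f g : measurable_fun setT f -> measurable_fun setT g ->
  ae_eq mu setT f g -> mean f = mean g.
Proof.
move=> mf mg fg; rewrite /mean; congr (_ / _); apply: Rintegral_ae_eq => //.
- exact: measurable_funTS.
- exact: measurable_funTS.
- exact: ae_eq_subset fg.
Qed.

Lemma Rintegral_derivative (F f : R -> R) (a b : R) : a <= b ->
  (forall x : R, is_derive x (1 : R) F (f x)) -> continuous f ->
  \int[mu]_(x in `[a, b]) f x = F b - F a.
Proof.
rewrite le_eqVlt => /predU1P[<-|ab] dF cf.
  by rewrite set_itv1 Rintegral_set1 subrr.
have cF : continuous F.
  move=> x; apply: differentiable_continuous; apply/derivable1_diffP.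
  by have [] := dF x.
rewrite /Rintegral (@continuous_FTC2 _ f F)//=.
- exact: continuous_subspaceT.
- split; [|exact: cvg_at_right_filter (cF a)|exact: cvg_at_left_filter (cF b)].
  by move=> x _; have [] := dF x.
- by move=> x _; rewrite derive1E; exact: derive_val.
Qed.

Lemma mean_derivative (F f : R -> R) : periodic F (2 * pi) ->
  (forall x : R, is_derive x (1 : R) F (f x)) -> continuous f -> mean f = 0.
Proof.
move=> pF dF cf; rewrite /mean (@Rintegral_derivative F)//; last first.
  by have := pi_gt0 R; lra.
have -> : F pi = F (- pi) by rewrite -(pF (- pi)); congr F; ring.
by rewrite subrr mul0r.
Qed.

Lemma mean_cst (c : R) : mean (fun=> c) = c.
Proof.
have p0 := pi_gt0 R.
have d (x : R) : is_derive x (1 : R) (fun x : R => c * x) c.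
  have -> : (fun x => c * x) = c \*: (@idfun R) by [].
  by apply: is_derive_eq; rewrite /GRing.scale/= mulr1.
rewrite /mean (_ : \int[mu]_(x in circle) c = c * pi - c * - pi).
  have pn0 : (pi : R) != 0 by rewrite gt_eqF.
  by move: (pi : R) pn0 => p pn0; field.
apply: (Rintegral_derivative _ d); first lra.
by move=> x; exact: cvg_cst.
Qed.

Lemma integrable_on_cst (c a b : R) : integrable_on `[a, b] (fun=> c).
Proof. by apply: integrable_on_cont => x; exact: cvg_cst. Qed.

End CircleIntegrals.

(** * Trigonometric modes and their orthogonality *)

Section Trigonometric.
Context {R : realType}.
Implicit Types (f g : R -> R) (z : int) (k j : nat).
Local Notation mu := (@lebesgue_measure R).
Local Notation circle := `[- (pi : R), pi]%classic.

Lemma is_derive_cosM (c x : R) :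
  is_derive x (1 : R) (fun t : R => cos (c * t)) (- (c * sin (c * x))).
Proof.
have -> : (fun t => cos (c * t)) = cos \o (c \*: (@idfun R)) by [].
by apply: is_derive_eq; rewrite /GRing.scale/= mulr1; ring.
Qed.

Lemma is_derive_sinM (c x : R) :
  is_derive x (1 : R) (fun t : R => sin (c * t)) (c * cos (c * x)).
Proof.
have -> : (fun t => sin (c * t)) = sin \o (c \*: (@idfun R)) by [].
by apply: is_derive_eq; rewrite /GRing.scale/= mulr1; ring.
Qed.

Lemma continuous_cosM (c : R) : continuous (fun t : R => cos (c * t)).
Proof.
by move=> x; apply: continuous_comp; [exact: mulrl_continuous|exact: continuous_cos].
Qed.

Lemma continuous_sinM (c : R) : continuous (fun t : R => sin (c * t)).
Proof.
by move=> x; apply: continuous_comp; [exact: mulrl_continuous|exact: continuous_sin].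
Qed.

Lemma cos_sin_period k (x : R) :
  cos (x + k%:R * (2 * pi)) = cos x /\ sin (x + k%:R * (2 * pi)) = sin x.
Proof.
have -> : k%:R * (2 * pi) = (pi *+ 2) *+ k :> R by rewrite mulr_natl mulr_natl.
by rewrite (periodicn (@cosD2pi R)) (periodicn (@sinD2pi R)).
Qed.

Lemma cos_sin_periodz z (x : R) :
  cos (x + z%:~R * (2 * pi)) = cos x /\ sin (x + z%:~R * (2 * pi)) = sin x.
Proof.
case: (intP z) => [|k|k].
- by rewrite mul0r addr0.
- exact: (cos_sin_period k.+1).
- set y := x + _.
  have -> : x = y + k.+1%:R * (2 * pi) by rewrite /y mulrNz; ring.
  by have [-> ->] := cos_sin_period k.+1 y.
Qed.

Lemma periodic_cosM z : periodic (fun t : R => cos (z%:~R * t)) (2 * pi).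
Proof. by move=> t; rewrite mulrDr; have [->] := cos_sin_periodz z (z%:~R * t). Qed.

Lemma periodic_sinM z : periodic (fun t : R => sin (z%:~R * t)) (2 * pi).
Proof. by move=> t; rewrite mulrDr; have [_ ->] := cos_sin_periodz z (z%:~R * t). Qed.

Lemma mean_cosM z : mean (fun x : R => cos (z%:~R * x)) = (z == 0)%:R.
Proof.
have [->|z0] := eqVneq z 0.
  rewrite -[RHS](mean_cst (1 : R)); congr mean; apply/funext => x.
  by rewrite mul0r cos0.
have zr0 : (z%:~R : R) != 0 by rewrite intr_eq0.
apply: (@mean_derivative _ (fun x => z%:~R^-1 * sin (z%:~R * x))).
- by move=> t; rewrite periodic_sinM.
- move=> x.
  have -> : (fun t => z%:~R^-1 * sin (z%:~R * t)) =
    z%:~R^-1 \*: (fun t : R => sin (z%:~R * t)) by [].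
  have d := is_derive_sinM z%:~R x.
  by apply: is_derive_eq; rewrite /GRing.scale/= mulKf.
- exact: continuous_cosM.
Qed.

Lemma mean_sinM z : mean (fun x : R => sin (z%:~R * x)) = 0.
Proof.
have [->|z0] := eqVneq z 0.
  rewrite -[RHS](mean_cst (0 : R)); congr mean; apply/funext => x.
  by rewrite mul0r sin0.
have zr0 : (z%:~R : R) != 0 by rewrite intr_eq0.
apply: (@mean_derivative _ (fun x => - z%:~R^-1 * cos (z%:~R * x))).
- by move=> t; rewrite periodic_cosM.
- move=> x.
  have -> : (fun t => - z%:~R^-1 * cos (z%:~R * t)) =
    (- z%:~R^-1) \*: (fun t : R => cos (z%:~R * t)) by [].
  have d := is_derive_cosM z%:~R x.
  by apply: is_derive_eq; rewrite /GRing.scale/= mulrNN mulKf.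
- exact: continuous_sinM.
Qed.

(** The index [k] stands for the frequency [k + 1]: the constant mode is
    excluded, and series over positive frequencies start at index 0. *)
Definition cosk k (x : R) : R := cos (k.+1%:R * x).
Definition sink k (x : R) : R := sin (k.+1%:R * x).

(** The complex coefficient of [f] at frequency [k + 1] is
    [fcos f k - i * fsin f k]. *)
Definition fcos f k : R := mean (fun x => f x * cosk k x).
Definition fsin f k : R := mean (fun x => f x * sink k x).

Lemma continuous_cosk k : continuous (cosk k). Proof. exact: continuous_cosM. Qed.
Lemma continuous_sink k : continuous (sink k). Proof. exact: continuous_sinM. Qed.

Lemma measurable_cosk k : measurable_fun setT (cosk k).
Proof. by apply: continuous_measurable_fun; exact: continuous_cosk. Qed.
Lemma measurable_sink k : measurable_fun setT (sink k).
Proof. by apply: continuous_measurable_fun; exact: continuous_sink. Qed.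

Lemma periodic_cosk k : periodic (cosk k) (2 * pi).
Proof. exact: (periodic_cosM k.+1%:Z). Qed.
Lemma periodic_sink k : periodic (sink k) (2 * pi).
Proof. exact: (periodic_sinM k.+1%:Z). Qed.

Lemma mean_cosk k : mean (cosk k) = 0.
Proof. exact: (mean_cosM k.+1%:Z). Qed.
Lemma mean_sink k : mean (sink k) = 0.
Proof. exact: (mean_sinM k.+1%:Z). Qed.

Lemma mean_half_add f g : integrable_on circle f -> integrable_on circle g ->
  mean (fun x => 2^-1 * (f x + g x)) = 2^-1 * (mean f + mean g).
Proof.
move=> If Ig; rewrite mean_scale; last exact: integrable_on_add.
by rewrite mean_add.
Qed.

Lemma mean_half_sub f g : integrable_on circle f -> integrable_on circle g ->
  mean (fun x => 2^-1 * (f x - g x)) = 2^-1 * (mean f - mean g).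
Proof.
move=> If Ig; rewrite mean_scale; last exact: integrable_on_sub.
by rewrite mean_sub.
Qed.

Lemma integrable_on_cosM (c a b : R) : integrable_on `[a, b] (fun x => cos (c * x)).
Proof. by apply: integrable_on_cont; exact: continuous_cosM. Qed.
Lemma integrable_on_sinM (c a b : R) : integrable_on `[a, b] (fun x => sin (c * x)).
Proof. by apply: integrable_on_cont; exact: continuous_sinM. Qed.

Let freq_sub_eq0 k j : (k.+1%:Z - j.+1%:Z == 0) = (k == j).
Proof. by rewrite subr_eq0 eqz_nat eqSS. Qed.

Let freq_sub k j : (k.+1%:Z - j.+1%:Z)%:~R = k.+1%:R - j.+1%:R :> R.
Proof. by rewrite intrB. Qed.
Let freq_add k j : (k.+1%:Z + j.+1%:Z)%:~R = k.+1%:R + j.+1%:R :> R.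
Proof. by rewrite intrD. Qed.

Lemma fcos_cosk k j : fcos (cosk k) j = (k == j)%:R / 2.
Proof.
rewrite /fcos (_ : (fun x => _) = fun x => 2^-1 *
  (cos ((k.+1%:Z - j.+1%:Z)%:~R * x) + cos ((k.+1%:Z + j.+1%:Z)%:~R * x))).
  rewrite mean_half_add; [|exact: integrable_on_cosM..].
  by rewrite !mean_cosM freq_sub_eq0 addr0 mulrC.
apply/funext => x; rewrite freq_sub freq_add mulrBl mulrDl cosB cosD /cosk; by field.
Qed.

Lemma fsin_sink k j : fsin (sink k) j = (k == j)%:R / 2.
Proof.
rewrite /fsin (_ : (fun x => _) = fun x => 2^-1 *
  (cos ((k.+1%:Z - j.+1%:Z)%:~R * x) - cos ((k.+1%:Z + j.+1%:Z)%:~R * x))).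
  rewrite mean_half_sub; [|exact: integrable_on_cosM..].
  by rewrite !mean_cosM freq_sub_eq0 subr0 mulrC.
apply/funext => x; rewrite freq_sub freq_add mulrBl mulrDl cosB cosD /sink; by field.
Qed.

Lemma fcos_sink k j : fcos (sink k) j = 0.
Proof.
rewrite /fcos (_ : (fun x => _) = fun x => 2^-1 *
  (sin ((k.+1%:Z - j.+1%:Z)%:~R * x) + sin ((k.+1%:Z + j.+1%:Z)%:~R * x))).
  rewrite mean_half_add; [|exact: integrable_on_sinM..].
  by rewrite !mean_sinM addr0 mulr0.
apply/funext => x; rewrite freq_sub freq_add mulrBl mulrDl sinB sinD /sink /cosk; by field.
Qed.

Lemma fsin_cosk k j : fsin (cosk k) j = 0.
Proof.
rewrite -(fcos_sink j k) /fsin /fcos; congr mean; apply/funext => x.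
exact: mulrC.
Qed.

End Trigonometric.

(** * Integrals over arcs of functions with vanishing Fourier coefficients *)

Section Uniqueness.
Context {R : realType}.
Implicit Types (f g : R -> R).
Local Notation mu := (@lebesgue_measure R).
Local Notation circle := `[- (pi : R), pi]%classic.

Lemma Rintegral_dominated (D : set R) (u : nat -> R -> R) f g : measurable D ->
  (forall n, measurable_fun D (u n)) -> measurable_fun D f ->
  {ae mu, forall x, D x -> u n x @[n --> \oo] --> f x} ->
  integrable_on D g -> (forall n x, D x -> `|u n x| <= g x) ->
  integrable_on D f /\
  \int[mu]_(x in D) u n x @[n --> \oo] --> \int[mu]_(x in D) f x.
Proof.
move=> mD mu_ mf uf Ig ug.
have [||||If _ lim] := @dominated_convergence _ _ _ mu D mD
    (fun n => EFin \o u n) (EFin \o f) (EFin \o g) _ _ _ Ig.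
- by move=> n; apply/measurable_EFinP; exact: mu_.
- by apply/measurable_EFinP.
- apply: filterS uf; first exact: (ae_filter_ringOfSetsType mu).
  by move=> x ux Dx; apply: cvg_EFin; [exact: nearW|exact: ux].
- by apply: aeW => x n Dx; rewrite lee_fin; exact: ug.
split => //.
apply: fine_cvg; rewrite /Rintegral fineK//.
exact: (integrable_fin_num (mu := mu)).
Qed.

(** Stone's polynomials [(1 - v ^ n) ^ (2 ^ n)] take values in [0, 1] on [0, 1]
    and converge there to a step at 1/2.  Below 1/2, Bernoulli's inequality
    bounds them from below by [1 - (2 v) ^ n]. *)
Lemma cvg_stone_lt (v : R) : 0 <= v < 2^-1 ->
  (1 - v ^+ n) ^+ (2 ^ n) @[n --> \oo] --> (1 : R).
Proof.
move=> /andP[v0 v2].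
have bern (m : nat) (t : R) : 0 <= t <= 1 -> 1 - m%:R * t <= (1 - t) ^+ m.
  move=> /andP[t0 t1]; elim: m => [|m IH]; first by rewrite expr0 mul0r subr0.
  rewrite exprS; have t10 : 0 <= 1 - t by lra.
  apply: le_trans (ler_wpM2l t10 IH).
  rewrite -natr1; have : 0 <= m%:R * t * t by rewrite !mulr_ge0.
  by nra.
apply: (@squeeze_cvgr _ _ _ _ (fun n => 1 - (2 * v) ^+ n) (fun=> 1)).
- near=> n.
  have vn : 0 <= v ^+ n <= 1 by rewrite exprn_ge0//= exprn_ile1//; lra.
  apply/andP; split; last by rewrite exprn_ile1//; lra.
  apply: le_trans (bern _ _ vn).
  by rewrite exprMn natrX.
- rewrite -[X in _ --> X]subr0; apply: cvgB; first exact: cvg_cst.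
  by apply: cvg_expr; rewrite ger0_norm; lra.
- exact: cvg_cst.
Unshelve. all: by end_near. Qed.

(** Above 1/2, the inequality [(1 - t) ^ m * (1 + m * t) <= 1] bounds Stone's
    polynomials by the inverse of [(2 v) ^ n]. *)
Lemma cvg_stone_gt (v : R) : 2^-1 < v <= 1 ->
  (1 - v ^+ n) ^+ (2 ^ n) @[n --> \oo] --> (0 : R).
Proof.
move=> /andP[v2 v1].
have bern (m : nat) (t : R) : 0 <= t <= 1 -> (1 - t) ^+ m * (1 + m%:R * t) <= 1.
  move=> /andP[t0 t1]; elim: m => [|m IH].
    by rewrite expr0 mul0r addr0 mulr1.
  apply: le_trans IH; rewrite exprSr -mulrA ler_wpM2l ?exprn_ge0//; first lra.
  rewrite -natr1; have : 0 <= m%:R * t * t by rewrite !mulr_ge0.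
  by nra.
apply: (@squeeze_cvgr _ _ _ _ (fun=> 0) (fun n => (2 * v)^-1 ^+ n)).
- near=> n.
  have vn : 0 <= v ^+ n <= 1 by rewrite exprn_ge0//= ?exprn_ile1//; lra.
  have w0 : 0 <= (1 - v ^+ n) ^+ (2 ^ n).
    by rewrite exprn_ge0// subr_ge0; case/andP: vn.
  rewrite w0/= exprVn -[leRHS]mul1r ler_pdivlMr; last by rewrite exprn_gt0; lra.
  apply: le_trans (bern (2 ^ n)%N _ vn).
  by rewrite ler_wpM2l// exprMn natrX lerDr.
- exact: cvg_cst.
- apply: cvg_expr; rewrite ger0_norm; last by rewrite invr_ge0; lra.
  by rewrite invf_lt1; lra.
Unshelve. all: by end_near. Qed.

(** Orthogonality to all the modes, in a form that is visibly stable under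
    multiplication by a translate of the cosine: hence the arbitrary phase and
    the integer, possibly negative, frequency. *)
Definition annihilates f : Prop := integrable_on circle f /\
  forall (z : int) (d : R), mean (fun x => f x * cos (z%:~R * x - d)) = 0.

Lemma continuous_cosMB (c d : R) : continuous (fun x : R => cos (c * x - d)).
Proof.
move=> x; apply: continuous_comp; last exact: continuous_cos.
by apply: cvgB; [exact: mulrl_continuous|exact: cvg_cst].
Qed.

Lemma integrable_on_mul_cont f (h : R -> R) M : integrable_on circle f ->
  continuous h -> (forall x, `|h x| <= M) -> integrable_on circle (fun x => f x * h x).
Proof.
move=> If ch hM; apply: (integrable_on_mul (M := M) _ If) => //.
by apply: measurable_funTS; exact: continuous_measurable_fun.
Qed.

Lemma integrable_on_mul_cos f (c d : R) : integrable_on circle f ->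
  integrable_on circle (fun x => f x * cos (c * x - d)).
Proof.
by move=> If; apply: (integrable_on_mul_cont If (@continuous_cosMB c d)) => x;
  exact: cos_max.
Qed.

(** The frequency 0 is the mean, and parity reduces the negative frequencies to
    the positive ones. *)
Lemma annihilatesP f : integrable_on circle f -> mean f = 0 ->
  (forall k, fcos f k = 0) -> (forall k, fsin f k = 0) -> annihilates f.
Proof.
move=> If f0 fc fs; split => // z d.
have c0 (y : int) : mean (fun x => f x * cos (y%:~R * x)) = 0 /\
    mean (fun x => f x * sin (y%:~R * x)) = 0.
  case: (intP y) => [|k|k].
  - split; last first.
      rewrite -[RHS](mean_cst (0 : R)); congr mean; apply/funext => x.
      by rewrite mul0r sin0 mulr0.
    by rewrite -[RHS]f0; congr mean; apply/funext => x; rewrite mul0r cos0 mulr1.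
  - by split; [exact: fc|exact: fs].
  - split; first rewrite -[RHS](fc k); last rewrite -[RHS]oppr0 -(fs k) -[RHS]mulN1r.
      by congr mean; apply/funext => x; rewrite mulrNz mulNr cosN.
    rewrite /fsin -mean_scale.
      by congr mean; apply/funext => x; rewrite mulrNz mulNr sinN mulN1r mulrN.
    apply: (@integrable_on_mul_cont f (sink k) 1) => //.
      exact: continuous_sink.
    by move=> x; exact: sin_max.
have [c1 s1] := c0 z.
have -> : (fun x => f x * cos (z%:~R * x - d)) = fun x =>
    cos d * (f x * cos (z%:~R * x)) + sin d * (f x * sin (z%:~R * x)).
  by apply/funext => x; rewrite cosB; ring.
have Ic : integrable_on circle (fun x => f x * cos (z%:~R * x)).
  by apply: (integrable_on_mul_cont If (@continuous_cosM R _)) => x; exact: cos_max.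
have Is : integrable_on circle (fun x => f x * sin (z%:~R * x)).
  by apply: (integrable_on_mul_cont If (@continuous_sinM R _)) => x; exact: sin_max.
rewrite mean_add; [|exact: integrable_on_scale..].
by rewrite !mean_scale// c1 s1 !mulr0 addr0.
Qed.

Lemma annihilates_scale f a : annihilates f -> annihilates (fun x => a * f x).
Proof.
move=> [If f0]; split; first exact: integrable_on_scale.
move=> z d; rewrite -[RHS](mulr0 a) -(f0 z d) -mean_scale.
  by congr mean; apply/funext => x; rewrite mulrA.
exact: integrable_on_mul_cos.
Qed.

Lemma annihilates_sub f g : annihilates f -> annihilates g ->
  annihilates (fun x => f x - g x).
Proof.
move=> [If f0] [Ig g0]; split; first exact: integrable_on_sub.
move=> z d; rewrite -[RHS](subr0 0) -{1}(f0 z d) -(g0 z d) -mean_sub.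
- by congr mean; apply/funext => x; rewrite mulrBl.
- exact: integrable_on_mul_cos.
- exact: integrable_on_mul_cos.
Qed.

(** The product of two modes is a sum of two modes. *)
Lemma annihilates_mul_cos f c : annihilates f -> annihilates (fun x => f x * cos (x - c)).
Proof.
move=> [If f0]; split.
  by have := integrable_on_mul_cos 1 c If; congr integrable_on; apply/funext => x; rewrite mul1r.
move=> z d.
have -> : (fun x => f x * cos (x - c) * cos (z%:~R * x - d)) = fun x => 2^-1 *
  (f x * cos ((z + 1)%:~R * x - (c + d)) + f x * cos ((z - 1)%:~R * x - (d - c))).
  apply/funext => x; rewrite intrD intrB.
  have -> : (z%:~R + 1%:~R) * x - (c + d) = (z%:~R * x - d) + (x - c) by ring.
  have -> : (z%:~R - 1%:~R) * x - (d - c) = (z%:~R * x - d) - (x - c) by ring.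
  by move: (z%:~R * x - d) (x - c) => A B; rewrite cosD cosB; field.
rewrite mean_half_add; [|exact: integrable_on_mul_cos..].
by rewrite !f0 addr0 mulr0.
Qed.

(** An affine function of [cos (x - c)] with values in [0, 1]; on the circle it is
    below 1/2 exactly on the arc of centre [c] and radius [r]. *)
Let window c r (x : R) : R := (2 + cos r) / 4 - cos (x - c) / 4.

(** Stone's polynomials in the window are trigonometric polynomials. *)
Lemma annihilates_window f c r n m : annihilates f ->
  annihilates (fun x => f x * (1 - window c r x ^+ n) ^+ m).
Proof.
have w1 g : annihilates g -> annihilates (fun x => g x * window c r x).
  move=> ag; have := annihilates_sub (annihilates_scale ((2 + cos r) / 4) ag)
    (annihilates_scale 4^-1 (annihilates_mul_cos c ag)).
  by congr annihilates; apply/funext => x; rewrite /window; ring.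
have wn g k : annihilates g -> annihilates (fun x => g x * window c r x ^+ k).
  move=> ag; elim: k => [|k /w1].
    by move: ag; congr annihilates; apply/funext => x; rewrite expr0 mulr1.
  by congr annihilates; apply/funext => x; rewrite exprSr mulrA.
move=> af; elim: m => [|m ag].
  by move: af; congr annihilates; apply/funext => x; rewrite expr0 mulr1.
have := annihilates_sub ag (wn _ n ag).
by congr annihilates; apply/funext => x; rewrite exprSr; ring.
Qed.

(** Stone's polynomials in the window of [[a, b]] converge boundedly to the
    indicator of [[a, b]], except at the end points, and [f] times each of them
    has mean zero. *)
Lemma annihilates_integral f a b : annihilates f -> - pi < a -> a < b -> b < pi ->
  \int[mu]_(x in `[a, b]) f x = 0.
Proof.
move=> af api ab bpi; have [If _] := af.
have mf := measurable_on_integrable If.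
pose c := (a + b) / 2; pose r := (b - a) / 2.
have p0 := pi_gt0 R.
have r0 : 0 < r by rewrite /r; lra.
have rpi : r < pi by rewrite /r; lra.
(* [c] and [r] are chosen so that the arc is exactly [[a, b]] *)
pose u n x := f x * (1 - window c r x ^+ n) ^+ (2 ^ n).
pose F x : R := f x * \1_(`[a, b]%classic) x.
(* points of the circle are at distance less than [2 * pi - r] from [c]; beyond
   distance [pi] the cosine grows again, but stays below [cos r] *)
have cosr (t : R) : - (2 * pi - r) < t < 2 * pi - r ->
    [/\ `|t| < r -> cos r < cos t & r < `|t| -> cos t < cos r].
  rewrite -ltr_norml => t1; rewrite -(cos_norm t); set s := `|t| in t1 *.
  have s0 : 0 <= s by rewrite /s.
  split=> [sr|rs]; first by rewrite ltr_cos ?in_itv/=; lra.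
  have [sp|ps] := lerP s pi; first by rewrite ltr_cos ?in_itv/=; lra.
  have -> : cos s = cos (2 * pi - s).
    rewrite -(cosN (2 * pi - s)) opprB.
    by rewrite -(@cosD2pi R (s - 2 * pi)); congr cos; ring.
  by rewrite ltr_cos ?in_itv/=; lra.
have wE x : window c r x = 2^-1 - (cos (x - c) - cos r) / 4.
  by rewrite /window; field.
have w01 x : 0 <= window c r x <= 1.
  have := (cos_le1 (x - c), cos_geN1 (x - c), cos_le1 r, cos_geN1 r).
  by rewrite wE => -[[[? ?] ?] ?]; lra.
have cw : continuous (window c r).
  move=> x; apply: cvgB; first exact: cvg_cst.
  apply: cvgM; last exact: cvg_cst.
  have := @continuous_cosMB 1 c x; rewrite /continuous_at mul1r.
  by under eq_fun do rewrite mul1r.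
have [||||||_] := @Rintegral_dominated circle u F (fun x => `|f x|) _ _ _ _ _ _.
- exact: measurable_itv.
- move=> n; apply: measurable_funM => //; apply: measurable_funX.
  apply: measurable_funB => //; apply: measurable_funX.
  by apply: measurable_funTS; exact: continuous_measurable_fun.
- by apply: measurable_funM => //; exact: measurable_indic.
- have nul (t : R) : mu.-negligible [set t].
    by apply/negligibleP; [exact: measurable_set1|exact: lebesgue_measure_set1].
  apply: negligibleS (negligibleU (nul a) (nul b)).
  + move=> x /= /not_implyP[]; rewrite in_itv/= => /andP[x1 x2].
    apply: contra_notP => /not_orP[/eqP xa /eqP xb].
    apply: cvgM; first exact: cvg_cst.
    have [|lo hi] := cosr (x - c); first by rewrite /c /r; lra.
    rewrite indicE; have [xab|xab] := boolP (x \in `[a, b]%classic).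
      apply: cvg_stone_lt; rewrite wE.
      have := w01 x; rewrite wE => /andP[-> _]/=.
      suff : cos r < cos (x - c) by lra.
      apply: lo; rewrite ltr_norml /c /r.
      move: xab; rewrite inE/= in_itv/= => /andP[ax xb'].
      have ax' : a < x by rewrite lt_neqAle eq_sym xa.
      have xb2 : x < b by rewrite lt_neqAle xb.
      by lra.
    apply: cvg_stone_gt; rewrite wE.
    have := w01 x; rewrite wE => /andP[_ ->]/=; rewrite andbT.
    suff : cos (x - c) < cos r by lra.
    apply: hi; rewrite ltr_normr /c /r.
    move: xab; rewrite notin_setE/= in_itv/= => /negP; rewrite negb_and -!ltNge.
    by case/orP => ?; apply/orP; [right|left]; lra.
- exact: integrable_on_norm.
- move=> n x _; rewrite normrM ler_piMr// ger0_norm.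
    rewrite exprn_ile1//; have /andP[? ?] := w01 x.
      by rewrite subr_ge0 exprn_ile1.
    by rewrite lerBlDr lerDl exprn_ge0.
  by rewrite exprn_ge0// subr_ge0; have /andP[? ?] := w01 x; rewrite exprn_ile1.
have u0 n : \int[mu]_(x in circle) u n x = 0.
  have [_ /(_ 0 0)] := annihilates_window c r n (2 ^ n) af.
  under [X in mean X]eq_fun do rewrite mul0r subr0 cos0 mulr1.
  rewrite /mean => /eqP; rewrite mulf_eq0 invr_eq0 mulf_eq0 pnatr_eq0/=.
  by rewrite (gt_eqF p0) orbF => /eqP.
have -> : (fun n => \int[mu]_(x in circle) u n x) = fun=> 0 by exact/funext.
have FE : \int[mu]_(x in circle) F x = \int[mu]_(x in `[a, b]) f x.
  rewrite -[in RHS](_ : circle `&` `[a, b]%classic = `[a, b]%classic).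
    rewrite Rintegral_mkcondr; apply: eq_Rintegral => x _.
    by rewrite /F /patch indicE; case: ifP; rewrite (mulr1, mulr0).
  by apply/setIidr => x /=; rewrite !in_itv/= => /andP[? ?]; lra.
rewrite FE => /(cvg_lim (@Rhausdorff R)) <-.
by rewrite lim_cst//; exact: Rhausdorff.
Qed.

End Uniqueness.

(** * Uniqueness almost everywhere *)

Section UniquenessAE.
Context {R : realType}.
Implicit Types (f g : R -> R).
Local Notation mu := (@lebesgue_measure R).
Local Notation circle := `[- (pi : R), pi]%classic.

(** The primitive of [f] is constant inside the circle, and almost everywhere
    its derivative is [f]. *)
Lemma annihilates_ae_in f : annihilates f ->
  {ae mu, forall x, - pi < x < pi -> f x = 0}.
Proof.
move=> af; have [If _] := af.
pose g := f \_ circle.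
have Ig : mu.-integrable setT (EFin \o g).
  have := If; rewrite /integrable_on integrable_mkcond//.
  by apply: eq_integrable => // x _; rewrite /= /g /patch; case: ifP.
have Igs (D : set R) : measurable D -> integrable_on D g.
  by move=> mD; exact: (integrableS (mu := mu) measurableT mD).
have lg : locally_integrable setT g by exact: open_integrable_locally openT Ig.
have gin (x : R) : - pi < x < pi -> g x = f x.
  by move=> /andP[? ?]; rewrite /g /patch mem_set//= in_itv/=; lra.
have gab (a b : R) : - pi < a -> a < b -> b < pi -> \int[mu]_(x in `[a, b]) g x = 0.
  move=> pa ab bp; rewrite -(annihilates_integral af pa ab bp).
  by apply: eq_Rintegral => x; rewrite inE/= in_itv/= => /andP[? ?]; apply: gin; lra.
have Igy (y : R) : mu.-integrable `]-oo, y] (EFin \o g) by apply: Igs.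
have := FTC1Ny Igy lg.
apply: filterS; first exact: (ae_filter_ringOfSetsType mu).
move=> x [dF Fx] /andP[x1 x2]; rewrite -gin ?x1// -Fx derive1E.
set F := (F in 'D_1 F x).
have Fab (a b : R) : - pi < a -> a < b -> b < pi -> F b = F a.
  move=> pa ab bp; apply/eqP; rewrite -subr_eq0; apply/eqP.
  rewrite /F Rintegral_itvB//=; last by rewrite bnd_simp ltW.
  rewrite Rintegral_itv_obnd_cbnd; first exact: gab.
  by apply: Igs.
rewrite (@near_eq_derive _ _ _ F (cst (F x)) x 1)//; first by rewrite derive_cst.
near=> y.
have y1 : - pi < y by near: y; exact: lt_nbhsr.
have y2 : y < pi by near: y; exact: lt_nbhsl.
by have [xy|yx|->] := ltgtP x y => //; [exact: Fab|symmetry; exact: Fab].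
Unshelve. all: by end_near. Qed.

(** The image of Lebesgue measure under a translation agrees with it on
    intervals, hence everywhere. *)
Lemma negligible_shift (A : set R) (c : R) : mu.-negligible A ->
  mu.-negligible [set x | A (x + c)].
Proof.
move=> [N [mN N0 AN]].
have mc : measurable_fun [set: measurableTypeR R] (fun x : R => x + c : measurableTypeR R).
  by apply: measurable_funD.
exists [set x | N (x + c)]; split.
- by have := mc measurableT N mN; rewrite setTI.
- rewrite -N0; symmetry.
  have := @lebesgue_measure_unique R (pushforward mu (fun x : R => x + c : measurableTypeR R)).
  apply => //.
  move=> _ [[u v]] _ <-; rewrite /pushforward/=.
  rewrite [X in _ = lebesgue_measure X](_ : _ = `]u - c, v - c]%classic).
    rewrite !lebesgue_measure_itv/= !lte_fin ltrD2r; case: ifP => // _.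
    by rewrite -!EFinB; congr EFin; ring.
  by apply/seteqP; split => x /=; rewrite !in_itv/= ltrBlDr lerBrDr.
- by move=> x /=; exact: AN.
Qed.

(** The exceptional set is a countable union of translates of its trace on one
    period. *)
Lemma ae_eq_periodic f g : periodic f (2 * pi) -> periodic g (2 * pi) ->
  {ae mu, forall x, - pi < x < pi -> f x = g x} -> ae_eq mu setT f g.
Proof.
move=> pf pg fg.
pose B := [set x : R | - pi <= x <= pi /\ f x <> g x].
have nB : mu.-negligible B.
  have nul (t : R) : mu.-negligible [set t].
    by apply/negligibleP; [exact: measurable_set1|exact: lebesgue_measure_set1].
  apply: negligibleS (negligibleU fg (negligibleU (nul (- pi)) (nul pi))).
  move=> x [/andP[x1 x2] fgx].
  have [->|xp] := eqVneq x pi; first by right; right.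
  have [->|xNp] := eqVneq x (- pi); first by right; left.
  left => /= H; apply: fgx; apply: H.
  by rewrite !lt_neqAle x1 x2 xp eq_sym xNp.
have per h (z : int) x : periodic h (2 * pi) -> h (x + z%:~R * (2 * pi)) = h x.
  move=> ph; have pn k y : h (y + k%:R * (2 * pi)) = h y.
    by rewrite mulr_natl (periodicn ph).
  case: (intP z) => [|k|k]; [by rewrite mul0r addr0|exact: pn|].
  by rewrite -[LHS](pn k.+1); congr h; rewrite mulrNz; ring.
have : mu.-negligible (\bigcup_(n : nat)
    ([set x | B (x + n%:Z%:~R * (2 * pi))] `|` [set x | B (x + (- n%:Z)%:~R * (2 * pi))])).
  by apply: negligible_bigcup => n; apply: negligibleU; exact: negligible_shift.
apply: negligibleS => x /= /not_implyP[_ fgx].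
(* the number of periods that brings [x] back to the circle *)
pose z : int := - Num.floor ((x + pi) / (2 * pi)).
have p0 := pi_gt0 R.
have zB : B (x + z%:~R * (2 * pi)).
  split; last by rewrite !per.
  have /andP[l u] := floor_itv ((x + pi) / (2 * pi) : R).
  move: l u; rewrite intrD ler_pdivlMr; last by lra.
  rewrite ltr_pdivrMr; last by lra.
  rewrite /z mulrNz; set t := _%:~R => l u.
  move: l u p0; move: (pi : R) => p; rewrite mulr1z => l u p0.
  by apply/andP; split; nra.
exists `|z|%N => //; case: (intP z) zB => [|k|k] zB; [left|left|right]; move: zB.
- by [].
- by rewrite absz_nat.
- by rewrite abszN absz_nat.
Qed.

Lemma trig_coef_unique f g : periodic f (2 * pi) -> periodic g (2 * pi) ->
  integrable_on circle f -> integrable_on circle g ->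
  mean f = mean g -> fcos f =1 fcos g -> fsin f =1 fsin g -> ae_eq mu setT f g.
Proof.
move=> pf pg If Ig m fc fs; apply: ae_eq_periodic => //.
have : annihilates (fun x => f x - g x).
  apply: annihilatesP; first exact: integrable_on_sub.
  - by rewrite mean_sub// m subrr.
  - move=> k; rewrite /fcos; under [X in mean X]eq_fun do rewrite mulrBl.
    rewrite mean_sub; first by rewrite -/(fcos f k) -/(fcos g k) fc subrr.
    + by apply: (@integrable_on_mul_cont _ f (cosk k) 1) => //;
        [exact: continuous_cosk|move=> x; exact: cos_max].
    + by apply: (@integrable_on_mul_cont _ g (cosk k) 1) => //;
        [exact: continuous_cosk|move=> x; exact: cos_max].
  - move=> k; rewrite /fsin; under [X in mean X]eq_fun do rewrite mulrBl.
    rewrite mean_sub; first by rewrite -/(fsin f k) -/(fsin g k) fs subrr.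
    + by apply: (@integrable_on_mul_cont _ f (sink k) 1) => //;
        [exact: continuous_sink|move=> x; exact: sin_max].
    + by apply: (@integrable_on_mul_cont _ g (sink k) 1) => //;
        [exact: continuous_sink|move=> x; exact: sin_max].
move=> /annihilates_ae_in; apply: filterS.
  exact: (ae_filter_ringOfSetsType mu).
by move=> x H /H/eqP; rewrite subr_eq0 => /eqP.
Qed.

End UniquenessAE.

(** * Absolutely convergent trigonometric series *)

Section TrigSeries.
Context {R : realType}.
Implicit Types (f g h : R -> R) (a b : nat -> R) (k : nat).
Local Notation mu := (@lebesgue_measure R).
Local Notation circle := `[- (pi : R), pi]%classic.

Definition abs_summable a b : Prop := cvgn (series (fun k => `|a k| + `|b k|)).

Definition trig_term a b (x : R) k : R := a k * cosk k x + b k * sink k x.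

Definition trig_sum a b (x : R) : R := limn (series (trig_term a b x)).

Lemma eq_cvg_seq (u v : nat -> R) (l : R) : u =1 v -> u @ \oo --> l -> v @ \oo --> l.
Proof. by move=> /funext ->. Qed.

Lemma trig_term_le a b x k : `|trig_term a b x k| <= `|a k| + `|b k|.
Proof.
apply: le_trans (ler_normD _ _) _; apply: lerD; rewrite normrM ler_piMr//.
- exact: cos_max.
- exact: sin_max.
Qed.

Lemma cvg_trig_sum a b x : abs_summable a b ->
  series (trig_term a b x) @ \oo --> trig_sum a b x.
Proof.
move=> ab; apply: normed_cvg; apply: series_le_cvg ab => k /=.
- exact: normr_ge0.
- by rewrite addr_ge0.
- exact: trig_term_le.
Qed.

Lemma trig_series_le a b x n : abs_summable a b ->
  `|series (trig_term a b x) n| <= limn (series (fun k => `|a k| + `|b k|)).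
Proof.
move=> ab; apply: (@le_trans _ _ (series (fun k => `|a k| + `|b k|) n)).
  rewrite /series/=; apply: le_trans (ler_norm_sum _ _ _) _.
  by apply: ler_sum => k _; exact: trig_term_le.
apply: nondecreasing_cvgn_le => //.
by apply: nondecreasing_series => k _ _; rewrite addr_ge0.
Qed.

Lemma measurable_trig_series a b n :
  measurable_fun setT (fun x => series (trig_term a b x) n).
Proof.
rewrite /series/=; apply: measurable_sum => k.
apply: measurable_funD; apply: measurable_funM => //.
- exact: measurable_cosk.
- exact: measurable_sink.
Qed.

Lemma measurable_trig_sum a b : abs_summable a b -> measurable_fun setT (trig_sum a b).
Proof.
move=> ab; apply: (measurable_fun_cvg (measurable_trig_series a b)) => x _.
exact: cvg_trig_sum.
Qed.

Lemma trig_sum_le a b x : abs_summable a b ->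
  `|trig_sum a b x| <= limn (series (fun k => `|a k| + `|b k|)).
Proof.
move=> ab; have lx := cvg_norm (@cvg_trig_sum a b x ab).

rewrite -(cvg_lim (@Rhausdorff R) (lx _)); apply: limr_le; first exact: cvgP (lx _).
by apply: nearW => n; exact: trig_series_le.
Qed.

Lemma periodic_trig_sum a b : periodic (trig_sum a b) (2 * pi).
Proof.
move=> x; rewrite /trig_sum; congr (limn (series _)); apply/funext => k.
by rewrite /trig_term periodic_cosk periodic_sink.
Qed.

(** The partial sums are uniformly bounded by the sum of the absolute values of
    the coefficients, so that dominated convergence applies.  The domain is
    arbitrary because the truncated Hilbert transform integrates over a domain
    that varies with the point. *)
Lemma cvg_Rintegral_trig_sum a b (D : set R) h : abs_summable a b ->
  measurable D -> integrable_on D h ->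
  integrable_on D (fun x => trig_sum a b x * h x) /\
  series (fun k => a k * (\int[mu]_(x in D) (cosk k x * h x)) +
                   b k * (\int[mu]_(x in D) (sink k x * h x))) @ \oo -->
    \int[mu]_(x in D) (trig_sum a b x * h x).
Proof.
move=> ab mD Ih; pose M := limn (series (fun k => `|a k| + `|b k|)).
have mh := measurable_on_integrable Ih.
have Ic k : integrable_on D (fun x => cosk k x * h x).
  rewrite (_ : (fun x => _) = fun x => h x * cosk k x).
    apply: (integrable_on_mul (M := 1)) => //; last by move=> x _; exact: cos_max.
    by apply: measurable_funTS; exact: measurable_cosk.
  by apply/funext => x; rewrite mulrC.
have Is k : integrable_on D (fun x => sink k x * h x).
  rewrite (_ : (fun x => _) = fun x => h x * sink k x).
    apply: (integrable_on_mul (M := 1)) => //; last by move=> x _; exact: sin_max.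
    by apply: measurable_funTS; exact: measurable_sink.
  by apply/funext => x; rewrite mulrC.
have [||||||If cv] := @Rintegral_dominated R D
  (fun n x => series (trig_term a b x) n * h x) (fun x => trig_sum a b x * h x)
  (fun x => M * `|h x|).
- by [].
- move=> n; apply: measurable_funM => //; apply: measurable_funTS.
  exact: measurable_trig_series.
- by apply: measurable_funM => //; apply: measurable_funTS; exact: measurable_trig_sum.
- apply: aeW => x _; apply: cvgM; last exact: cvg_cst.
  exact: cvg_trig_sum.
- by apply: integrable_on_scale => //; exact: integrable_on_norm.
- by move=> n x _; rewrite normrM ler_wpM2r//; exact: trig_series_le.
split => //; apply: eq_cvg_seq cv => n.
suff [_ ->] : integrable_on D (fun x => series (trig_term a b x) n * h x) /\
  \int[mu]_(x in D) (series (trig_term a b x) n * h x) =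
  series (fun k => a k * (\int[mu]_(x in D) (cosk k x * h x)) +
                   b k * (\int[mu]_(x in D) (sink k x * h x))) n by [].
elim: n => [|n [In IH]].
  rewrite /series/= big_geq//; split.
    have := integrable_on_scale 0 mD Ih.
    by congr integrable_on; apply/funext => x; rewrite big_geq// mul0r.
  under eq_Rintegral do rewrite big_geq// mul0r.
  by rewrite Rintegral_cst// mul0r.
have Ea : (fun x => series (trig_term a b x) n.+1 * h x) = fun x =>
    series (trig_term a b x) n * h x + (a n * (cosk n x * h x) + b n * (sink n x * h x)).
  by apply/funext => x; rewrite /series/= big_nat_recr//= /trig_term; ring.
have Iab : integrable_on D (fun x => a n * (cosk n x * h x) + b n * (sink n x * h x)).
  by apply: integrable_on_add => //; exact: integrable_on_scale.
rewrite Ea; split; first exact: integrable_on_add.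
rewrite RintegralD// IH [in RHS]/series/= big_nat_recr//=; congr (_ + _).
rewrite RintegralD//; [|exact: integrable_on_scale..].
by rewrite !RintegralZl//; [exact: Is|exact: Ic].
Qed.

Lemma cvg_mean_trig_sum a b h : abs_summable a b -> integrable_on circle h ->
  series (fun k => a k * fcos h k + b k * fsin h k) @ \oo -->
    mean (fun x => trig_sum a b x * h x).
Proof.
move=> ab Ih; have [//|_ +] := cvg_Rintegral_trig_sum ab _ Ih.
move=> /(cvgM (cvg_cst (2 * pi)^-1)).
rewrite [(2 * pi)^-1 * _]mulrC -/(mean _); apply: eq_cvg_seq => n.
rewrite /series/= big_distrr/=; apply: eq_bigr => k _.
rewrite /fcos /fsin /mean mulrDr; congr (_ + _); rewrite mulrCA; congr (_ * _).
  rewrite mulrC; congr (_ / _); apply: eq_Rintegral => x _; exact: mulrC.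
rewrite mulrC; congr (_ / _); apply: eq_Rintegral => x _; exact: mulrC.
Qed.

Lemma integrable_trig_sum a b : abs_summable a b -> integrable_on circle (trig_sum a b).
Proof.
move=> ab; have [//|+ _] := cvg_Rintegral_trig_sum ab _ (@integrable_on_cst R 1 (- pi) pi).
by congr integrable_on; apply/funext => x; rewrite mulr1.
Qed.

Lemma lim_series_single (u : nat -> R) j : (forall k, k != j -> u k = 0) ->
  series u @ \oo --> u j.
Proof.
move=> u0; apply: cvg_near_cst; near=> n.
rewrite /series/= big_mkord.
have jn : (j < n)%N by near: n; exact: nbhs_infty_gt.
by rewrite (bigD1 (Ordinal jn))//= big1 ?addr0// => i ij; exact: u0.
Unshelve. all: by end_near. Qed.

Lemma mean_trig_sum a b : abs_summable a b -> mean (trig_sum a b) = 0.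
Proof.
move=> ab; have := cvg_mean_trig_sum ab (@integrable_on_cst R 1 (- pi) pi).
rewrite (_ : (fun k => _) = fun=> 0).
  rewrite (_ : series _ = fun=> 0).
    move=> /(cvg_lim (@Rhausdorff R)); rewrite lim_cst; last exact: Rhausdorff.
    by under [X in mean X]eq_fun do rewrite mulr1.
  by apply/funext => n; rewrite /series/= big1.
apply/funext => k; rewrite /fcos /fsin.
under [X in mean X]eq_fun do rewrite mul1r.
under [X in _ + _ * mean X]eq_fun do rewrite mul1r.
by rewrite mean_cosk mean_sink !mulr0 addr0.
Qed.

(** By orthogonality, a single term of the termwise integral survives. *)
Lemma fcos_trig_sum a b j : abs_summable a b -> fcos (trig_sum a b) j = a j / 2.
Proof.
move=> ab; have Ic : integrable_on circle (@cosk R j).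
  by apply: integrable_on_cont; exact: continuous_cosk.
rewrite {1}/fcos -(cvg_lim (@Rhausdorff R) (cvg_mean_trig_sum ab Ic)).
apply/(cvg_lim (@Rhausdorff R)).
rewrite (_ : a j / 2 = a j * fcos (cosk j) j + b j * fsin (cosk j) j); last first.
  by rewrite fcos_cosk fsin_cosk eqxx mulr0 addr0 mul1r.
apply: lim_series_single => k kj.
by rewrite fcos_cosk fsin_cosk eq_sym (negbTE kj) mul0r !mulr0 addr0.
Qed.

Lemma fsin_trig_sum a b j : abs_summable a b -> fsin (trig_sum a b) j = b j / 2.
Proof.
move=> ab; have Ic : integrable_on circle (@sink R j).
  by apply: integrable_on_cont; exact: continuous_sink.
rewrite {1}/fsin -(cvg_lim (@Rhausdorff R) (cvg_mean_trig_sum ab Ic)).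
apply/(cvg_lim (@Rhausdorff R)).
rewrite (_ : b j / 2 = a j * fcos (sink j) j + b j * fsin (sink j) j); last first.
  by rewrite fcos_sink fsin_sink eqxx mulr0 add0r mul1r.
apply: lim_series_single => k kj.
by rewrite fcos_sink fsin_sink eq_sym (negbTE kj) mul0r !mulr0 addr0.
Qed.

Lemma L2_bounded f M : periodic f (2 * pi) -> measurable_fun setT f ->
  (forall x, `|f x| <= M) -> L2 f.
Proof.
move=> pf mf fM; split => //.
apply: (@integrable_on_bounded _ circle (fun x => f x ^+ 2)) (M ^+ 2) _.
- exact: measurable_itv.
- by rewrite lebesgue_measure_itv/=; case: ifP => _; rewrite ?ltry// -EFinB ltry.
- by apply: measurable_funX; exact: measurable_funTS.
- move=> x _; rewrite normrX lerXn2r// ?nnegrE//.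
  by apply: le_trans (fM 0).
Qed.

Lemma L2_trig_sum a b : abs_summable a b -> L2 (trig_sum a b).
Proof.
move=> ab; apply: L2_bounded; first exact: periodic_trig_sum.
- exact: measurable_trig_sum.
- by move=> x; exact: trig_sum_le.
Qed.

Lemma integrable_on_L2_mul f g : L2 f -> L2 g -> integrable_on circle (fun x => f x * g x).
Proof.
move=> [_ mf If] [_ mg Ig].
have Ifg : integrable_on circle (fun x => f x ^+ 2 + g x ^+ 2).
  by apply: integrable_on_add.
apply: (@le_integrable _ _ _ mu circle _ _ (EFin \o (fun x => f x ^+ 2 + g x ^+ 2))) Ifg.
- exact: measurable_itv.
- by apply/measurable_EFinP; apply: measurable_funTS; exact: measurable_funM.
- move=> x _; rewrite /= lee_fin [leRHS]ger0_norm ?addr_ge0 ?sqr_ge0//.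
  by rewrite ler_norml; apply/andP; split; nra.
Qed.

Lemma L2_integrable f : L2 f -> integrable_on circle f.
Proof.
move=> Lf; have L1 : L2 (fun _ : R => 1 : R).
  by apply: (@L2_bounded _ 1) => // x; rewrite normr1.
by have := integrable_on_L2_mul Lf L1; congr integrable_on; apply/funext => x; rewrite mulr1.
Qed.

Lemma abs_summable_le a b (v : nat -> R) :
  (forall k, `|a k| + `|b k| <= v k) -> cvgn (series v) -> abs_summable a b.
Proof.
move=> abv; have ab0 k : 0 <= `|a k| + `|b k| by rewrite addr_ge0.
by apply: series_le_cvg => // k; exact: le_trans (abv k).
Qed.

Lemma abs_summable_scale a b c : abs_summable a b ->
  abs_summable (fun k => c * a k) (fun k => c * b k).
Proof.
move=> ab; apply: (@abs_summable_le _ _ (`|c| *: (fun k => `|a k| + `|b k|))).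
  by move=> k; rewrite !normrM -mulrDr.
exact: is_cvg_seriesZ.
Qed.

(** The series has the coefficients of [f], so uniqueness applies. *)
Lemma fourier_inversion f : L2 f -> mean f = 0 -> abs_summable (fcos f) (fsin f) ->
  ae_eq mu setT f (trig_sum (fun k => 2 * fcos f k) (fun k => 2 * fsin f k)).
Proof.
move=> Lf f0 sf0; have sf := @abs_summable_scale _ _ 2 sf0; have [pf mf _] := Lf.
apply: trig_coef_unique => //.
- exact: periodic_trig_sum.
- exact: L2_integrable.
- exact: integrable_trig_sum.
- by rewrite mean_trig_sum.
- by move=> k; rewrite fcos_trig_sum// mulrC mulKf.
- by move=> k; rewrite fsin_trig_sum// mulrC mulKf.
Qed.

(** Since [f] is almost everywhere the sum of an absolutely convergent series,
    the pairing with any [g] is computed termwise. *)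
Lemma parseval f g : L2 f -> mean f = 0 -> abs_summable (fcos f) (fsin f) -> L2 g ->
  series (fun k => 2 * (fcos f k * fcos g k + fsin f k * fsin g k)) @ \oo -->
    mean (fun x => f x * g x).
Proof.
move=> Lf f0 sf Lg; have s2 := @abs_summable_scale _ _ 2 sf.
have [_ mf _] := Lf; have [_ mg _] := Lg.
have -> : mean (fun x => f x * g x) =
    mean (fun x => trig_sum (fun k => 2 * fcos f k) (fun k => 2 * fsin f k) x * g x).
  apply: mean_ae_eq.
  - exact: measurable_funM.
  - by apply: measurable_funM => //; exact: measurable_trig_sum.
  - by apply: filterS (fourier_inversion Lf f0 sf) => x /= H /H ->.
have := cvg_mean_trig_sum s2 (L2_integrable Lg).
apply: eq_cvg_seq => n; apply: eq_bigr => k _; ring.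
Qed.

End TrigSeries.

(** * Weak derivatives and Fourier coefficients *)

Section WeakDerivatives.
Context {R : realType}.
Implicit Types (f g h chi : R -> R) (a b : nat -> R) (k n : nat).
Local Notation mu := (@lebesgue_measure R).
Local Notation circle := `[- (pi : R), pi]%classic.

Lemma is_derive_trig (a b c x : R) :
  is_derive x (1 : R) (fun t : R => a * cos (c * t) + b * sin (c * t))
    (c * b * cos (c * x) + (- (c * a)) * sin (c * x)).
Proof.
have dc := is_derive_cosM c x; have ds := is_derive_sinM c x.
have -> : (fun t : R => a * cos (c * t) + b * sin (c * t)) =
  (a \*: (fun t : R => cos (c * t))) + (b \*: (fun t : R => sin (c * t))) by [].
by apply: is_derive_eq; rewrite /GRing.scale/=; ring.
Qed.

(** Combinations of a cosine and a sine of one frequency are stable under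
    differentiation, which makes the modes legitimate test functions. *)
Lemma derive1n_trig n (c a b : R) : exists a' b' : R,
  derive1n n (fun t : R => a * cos (c * t) + b * sin (c * t)) =
  (fun t : R => a' * cos (c * t) + b' * sin (c * t)).
Proof.
elim: n => [|n [a' [b' IH]]]; first by exists a, b.
exists (c * b'), (- (c * a')); apply/funext => x.
rewrite derive1nS IH derive1E.
by have := is_derive_trig a' b' c x => d; rewrite derive_val.
Qed.

Lemma test_trig (z : int) (a b : R) :
  test_function (fun t : R => a * cos (z%:~R * t) + b * sin (z%:~R * t)).
Proof.
split; first by move=> t; rewrite periodic_cosM periodic_sinM.
move=> n x; have [a' [b' ->]] := derive1n_trig n z%:~R a b.
by have [] := is_derive_trig a' b' z%:~R x.
Qed.

Lemma derive1_cosk k : derive1 (@cosk R k) = fun x => - k.+1%:R * sink k x.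
Proof.
apply/funext => x; rewrite derive1E /cosk; have := is_derive_cosM k.+1%:R x => d.
by rewrite derive_val mulNr.
Qed.

Lemma derive1_sink k : derive1 (@sink R k) = fun x => k.+1%:R * cosk k x.
Proof.
apply/funext => x; rewrite derive1E /sink; have := is_derive_sinM k.+1%:R x => d.
by rewrite derive_val.
Qed.

Lemma test_cosk k : test_function (@cosk R k).
Proof.
have := test_trig k.+1%:Z 1 0; congr test_function; apply/funext => t.
by rewrite mul1r mul0r addr0.
Qed.

Lemma test_sink k : test_function (@sink R k).
Proof.
have := test_trig k.+1%:Z 0 1; congr test_function; apply/funext => t.
by rewrite mul1r mul0r add0r.
Qed.

Lemma test_cst1 : test_function (fun _ : R => 1 : R).
Proof.
have := test_trig 0 1 0; congr test_function; apply/funext => t.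
by rewrite !mul0r cos0 mulr1 addr0.
Qed.

Lemma integrable_on_mul_cosk f k : integrable_on circle f ->
  integrable_on circle (fun x => f x * cosk k x).
Proof.
move=> If; apply: (@integrable_on_mul_cont _ f (cosk k) 1) => //.
  exact: continuous_cosk.
by move=> x; exact: cos_max.
Qed.

Lemma integrable_on_mul_sink f k : integrable_on circle f ->
  integrable_on circle (fun x => f x * sink k x).
Proof.
move=> If; apply: (@integrable_on_mul_cont _ f (sink k) 1) => //.
  exact: continuous_sink.
by move=> x; exact: sin_max.
Qed.

(** The definition of the weak derivative, tested against [cosk k]. *)
Lemma fcos_weak f g k : L2 f -> is_weak_derivative f g -> fcos g k = k.+1%:R * fsin f k.
Proof.
move=> /L2_integrable If /(_ _ (test_cosk k)); rewrite derive1_cosk.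
rewrite -/(fcos g k) => /esym/(congr1 -%R); rewrite opprK => ->.
rewrite /fsin -[RHS]mean_scale; last exact: integrable_on_mul_sink.
rewrite -[LHS]mulN1r -mean_scale.
  by congr mean; apply/funext => x; ring.
have := integrable_on_scale (- k.+1%:R) (measurable_itv _) (integrable_on_mul_sink k If).
by congr integrable_on; apply/funext => x; rewrite mulrCA.
Qed.

(** The definition of the weak derivative, tested against [sink k]. *)
Lemma fsin_weak f g k : L2 f -> is_weak_derivative f g ->
  fsin g k = - (k.+1%:R * fcos f k).
Proof.
move=> /L2_integrable If /(_ _ (test_sink k)); rewrite derive1_sink.
rewrite -/(fsin g k) => /esym/(congr1 -%R); rewrite opprK => ->.
congr (- _); rewrite /fcos -mean_scale; last exact: integrable_on_mul_cosk.
by congr mean; apply/funext => x; ring.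
Qed.

(** The definition of the weak derivative, tested against the constant 1. *)
Lemma mean_weak f g : is_weak_derivative f g -> mean g = 0.
Proof.
move=> /(_ _ test_cst1).
have -> : derive1 (fun _ : R => 1 : R) = fun=> 0.
  by apply/funext => x; rewrite derive1_cst.
under [X in mean X]eq_fun do rewrite mulr0.
under [X in - mean X]eq_fun do rewrite mulr1.
by rewrite mean_cst => /eqP; rewrite eq_sym oppr_eq0 => /eqP.
Qed.

Lemma continuous_test chi : test_function chi -> continuous chi.
Proof.
move=> [_ /(_ 0)] d x; apply: differentiable_continuous; exact/derivable1_diffP/d.
Qed.

Lemma continuous_derive1_test chi : test_function chi -> continuous (derive1 chi).
Proof.
move=> [_ /(_ 1)] d x; apply: differentiable_continuous; exact/derivable1_diffP/d.
Qed.

Lemma is_derive_test chi x : test_function chi -> is_derive x (1 : R) chi (derive1 chi x).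
Proof.
by move=> [_ /(_ 0) d]; apply: DeriveDef; [exact: d|rewrite derive1E].
Qed.

(** Integration by parts: the derivative of [chi * cosk k] has mean zero by
    periodicity. *)
Lemma fcos_derive1 chi k : test_function chi ->
  fcos (derive1 chi) k = k.+1%:R * fsin chi k.
Proof.
move=> tc; have cc := continuous_test tc; have cdc := continuous_derive1_test tc.
have Ic : integrable_on circle chi by exact: integrable_on_cont.
have Idc : integrable_on circle (derive1 chi) by exact: integrable_on_cont.
have : mean (fun x => derive1 chi x * cosk k x - k.+1%:R * (chi x * sink k x)) = 0.
  apply: (@mean_derivative _ (fun x => chi x * cosk k x)).
  - by move=> x; rewrite periodic_cosk; case: tc => ->.
  - move=> x; have d1 := is_derive_test x tc; have d2 := is_derive_cosM k.+1%:R x.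
    have -> : (fun x => chi x * cosk k x) = chi * (fun t : R => cos (k.+1%:R * t)) by [].
    by apply: is_derive_eq; rewrite /GRing.scale/= /cosk /sink; ring.
  - move=> x; apply: cvgB.
      by apply: cvgM; [exact: cdc|exact: continuous_cosk].
    apply: cvgM; first exact: cvg_cst.
    by apply: cvgM; [exact: cc|exact: continuous_sink].
rewrite mean_sub; [|exact: integrable_on_mul_cosk|].
  rewrite mean_scale; last exact: integrable_on_mul_sink.
  by move=> /eqP; rewrite subr_eq0 => /eqP.
by apply: integrable_on_scale => //; exact: integrable_on_mul_sink.
Qed.

(** Integration by parts: the derivative of [chi * sink k] has mean zero by
    periodicity. *)
Lemma fsin_derive1 chi k : test_function chi ->
  fsin (derive1 chi) k = - (k.+1%:R * fcos chi k).
Proof.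
move=> tc; have cc := continuous_test tc; have cdc := continuous_derive1_test tc.
have Ic : integrable_on circle chi by exact: integrable_on_cont.
have Idc : integrable_on circle (derive1 chi) by exact: integrable_on_cont.
have : mean (fun x => derive1 chi x * sink k x + k.+1%:R * (chi x * cosk k x)) = 0.
  apply: (@mean_derivative _ (fun x => chi x * sink k x)).
  - by move=> x; rewrite periodic_sink; case: tc => ->.
  - move=> x; have d1 := is_derive_test x tc; have d2 := is_derive_sinM k.+1%:R x.
    have -> : (fun x => chi x * sink k x) = chi * (fun t : R => sin (k.+1%:R * t)) by [].
    by apply: is_derive_eq; rewrite /GRing.scale/= /cosk /sink; ring.
  - move=> x; apply: cvgD.
      by apply: cvgM; [exact: cdc|exact: continuous_sink].
    apply: cvgM; first exact: cvg_cst.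
    by apply: cvgM; [exact: cc|exact: continuous_cosk].
rewrite mean_add; [|exact: integrable_on_mul_sink|].
  rewrite mean_scale; last exact: integrable_on_mul_cosk.
  by move=> /eqP; rewrite addr_eq0 => /eqP.
by apply: integrable_on_scale => //; exact: integrable_on_mul_cosk.
Qed.

(** Paired with a test function, both series are integrated termwise, and each
    term is an integration by parts of a smooth mode: the series themselves
    are never differentiated. *)
Lemma weak_derivative_trig_sum a b : abs_summable a b ->
  abs_summable (fun k => k.+1%:R * b k) (fun k => - (k.+1%:R * a k)) ->
  is_weak_derivative (trig_sum a b)
    (trig_sum (fun k => k.+1%:R * b k) (fun k => - (k.+1%:R * a k))).
Proof.
move=> ab ab' chi tc.
have Ic : integrable_on circle chi.
  by apply: integrable_on_cont; exact: continuous_test.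
have Idc : integrable_on circle (derive1 chi).
  by apply: integrable_on_cont; exact: continuous_derive1_test.
rewrite -(cvg_lim (@Rhausdorff R) (cvg_mean_trig_sum ab Idc)).
apply/(cvg_lim (@Rhausdorff R)).
have := cvg_mean_trig_sum ab' Ic => /cvgN; apply: eq_cvg_seq => n.
rewrite /series/= fctE -sumrN; apply: eq_bigr => k _.
by rewrite fcos_derive1// fsin_derive1//; ring.
Qed.

Lemma cvg_series_trunc (v : nat -> R) n :
  series (fun k => if (k < n)%N then v k else 0) @ \oo --> series v n.
Proof.
apply: cvg_near_cst; near=> m.
have nm : (n <= m)%N by near: m; exact: nbhs_infty_ge.
rewrite /series/= (big_cat_nat (leq0n n) nm)/=.
have -> : \sum_(n <= i < m) (if (i < n)%N then v i else 0) = 0 :> R.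
  rewrite big_nat_cond big1// => k /andP[/andP[nk _] _].
  by rewrite ltnNge nk.
by rewrite addr0; apply: eq_big_nat => k /andP[_ ->].
Unshelve. all: by end_near. Qed.

(** The mean of [(f - s) ^ 2] is nonnegative, where [s] is the truncated Fourier
    series of [f]; both the mean of [s * f] and that of [s ^ 2] equal the
    left-hand side. *)
Lemma bessel f n : L2 f ->
  2 * (\sum_(0 <= k < n) (fcos f k ^+ 2 + fsin f k ^+ 2)) <= mean (fun x => f x ^+ 2).
Proof.
move=> Lf.
(* a truncated series is treated as a full one, so that termwise integration
   applies to it *)
pose a k : R := if (k < n)%N then 2 * fcos f k else 0.
pose b k : R := if (k < n)%N then 2 * fsin f k else 0.
have ab : abs_summable a b.
  apply: cvgP; apply: eq_cvg_seq
    (@cvg_series_trunc (fun k => `|2 * fcos f k| + `|2 * fsin f k|) n) => m.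
  by apply: eq_bigr => k _; rewrite /a /b; case: ifP; rewrite ?normr0 ?addr0.
set Q := \sum_(0 <= k < n) (fcos f k ^+ 2 + fsin f k ^+ 2); pose s := trig_sum a b.
have Ls : L2 s := L2_trig_sum ab.
have msf : mean (fun x => s x * f x) = 2 * Q.
  rewrite -(cvg_lim (@Rhausdorff R) (cvg_mean_trig_sum ab (L2_integrable Lf))).
  apply/(cvg_lim (@Rhausdorff R)).
  have := @cvg_series_trunc (fun k => 2 * (fcos f k ^+ 2 + fsin f k ^+ 2)) n.
  rewrite /series/= -big_distrr/= -/Q; apply: eq_cvg_seq => m.
  by apply: eq_bigr => k _; rewrite /a /b; case: ifP => _; ring.
have mss : mean (fun x => s x * s x) = 2 * Q.
  rewrite -(cvg_lim (@Rhausdorff R) (cvg_mean_trig_sum ab (L2_integrable Ls))).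
  apply/(cvg_lim (@Rhausdorff R)).
  have := @cvg_series_trunc (fun k => 2 * (fcos f k ^+ 2 + fsin f k ^+ 2)) n.
  rewrite /series/= -big_distrr/= -/Q; apply: eq_cvg_seq => m.
  apply: eq_bigr => k _; rewrite fcos_trig_sum// fsin_trig_sum// /a /b.
  by case: ifP => _; field.
have Iff := integrable_on_L2_mul Lf Lf.
have Isf := integrable_on_L2_mul Ls Lf.
have Iss := integrable_on_L2_mul Ls Ls.
have : 0 <= mean (fun x => (f x * f x - 2 * (s x * f x)) + s x * s x).
  rewrite /mean divr_ge0//; last by rewrite mulr_ge0// pi_ge0.
  apply: Rintegral_ge0 => x _.
  by rewrite (_ : _ + _ = (f x - s x) ^+ 2) ?sqr_ge0//; ring.
have mi : measurable circle by exact: measurable_itv.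
rewrite mean_add//; last by apply: integrable_on_sub => //; exact: integrable_on_scale.
rewrite mean_sub//; last exact: integrable_on_scale.
rewrite mean_scale// msf mss.
rewrite (_ : (fun x => f x ^+ 2) = fun x => f x * f x); first by lra.
by apply/funext => x; rewrite expr2.
Qed.

(** The harmonic number of [k + 1].  It controls the truncated Hilbert transform
    of the mode of index [k]. *)
Definition harm k : R := \sum_(0 <= j < k.+1) j.+1%:R^-1.

Lemma harm_ge1 k : 1 <= harm k.
Proof.
by rewrite /harm big_nat_recl// invr1 lerDl sumr_ge0.
Qed.

(** The second term is modelled on the primitive
    [- (ln t ^ 2 + 2 * ln t + 2) / t] of [ln t ^ 2 / t ^ 2]; adding it turns the
    convergence of the series into a telescoping induction. *)
Lemma harm_sq_bound n : \sum_(0 <= k < n.+1) (harm k / k.+1%:R) ^+ 2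
  + (harm n ^+ 2 + 2 * harm n + 2) / n.+1%:R <= 6.
Proof.
elim: n => [|n IH].
  by rewrite big_nat1 /harm big_nat1 invr1 !mulr1; lra.
rewrite big_nat_recr//=; apply: le_trans IH; rewrite -addrA lerD2l.
have -> : harm n.+1 = harm n + n.+2%:R^-1 by rewrite /harm big_nat_recr.
have n0 : 0 < n.+1%:R :> R by [].
have -> : n.+2%:R = n.+1%:R + 1 :> R by rewrite natr1.
move: (harm n) (n.+1%:R : R) n0 => h m m0.
have m10 : m + 1 != 0 by rewrite gt_eqF//; lra.
have mn0 : m != 0 by rewrite gt_eqF.
rewrite -subr_ge0.
set e := (X in 0 <= X).
have -> : e = ((h + (m + 1)^-1) ^+ 2 + 1) / (m * (m + 1) ^+ 2).
  by rewrite /e; field; rewrite m10.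
by rewrite divr_ge0// ?addr_ge0 ?sqr_ge0// mulr_ge0 ?sqr_ge0// ltW.
Qed.

(** The coefficients of [f] are those of [g] divided by the frequency; the
    inequality [|x * w| <= (x ^ 2 + w ^ 2) / 2] separates the square-summable
    coefficients of [g] from the square-summable weights. *)
Lemma coef_weak_summable f g : L2 f -> L2 g -> is_weak_derivative f g ->
  abs_summable (fun k => harm k * fcos f k) (fun k => harm k * fsin f k).
Proof.
move=> Lf Lg fg.
pose v k : R := fcos g k ^+ 2 + fsin g k ^+ 2 + (harm k / k.+1%:R) ^+ 2.
apply: (@abs_summable_le _ _ _ v).
  move=> k; have k0 : (k.+1%:R : R) != 0 by [].
  have -> : fcos f k = - (fsin g k / k.+1%:R).
    by rewrite (fsin_weak k Lf fg); field.
  have -> : fsin f k = fcos g k / k.+1%:R.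
    by rewrite (fcos_weak k Lf fg); field.
  have -> : harm k * - (fsin g k / k.+1%:R) = - (fsin g k * (harm k / k.+1%:R)) by ring.
  have -> : harm k * (fcos g k / k.+1%:R) = fcos g k * (harm k / k.+1%:R) by ring.
  have amgm (x w : R) : `|x * w| <= (x ^+ 2 + w ^+ 2) / 2.
    have := sqr_ge0 (x + w); have := sqr_ge0 (x - w).
    by rewrite !expr2 ler_norml => ? ?; apply/andP; split; nra.
  rewrite normrN /v; move: (harm k / k.+1%:R) (fcos g k) (fsin g k) => w x y.
  by have := amgm x w; have := amgm y w; have := sqr_ge0 x; have := sqr_ge0 y; lra.
apply: nondecreasing_is_cvgn.
  by apply: nondecreasing_series => k _ _; rewrite !addr_ge0 ?sqr_ge0.
exists (mean (fun x => g x ^+ 2) / 2 + 6) => _ [n _ <-].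
rewrite /series/= big_split/=; apply: lerD.
  by rewrite ler_pdivlMr// mulrC; exact: bessel.
case: n => [|n]; first by rewrite big_geq.
apply: le_trans (harm_sq_bound n); rewrite lerDl divr_ge0//.
have := harm_ge1 n; nra.
Qed.

Lemma abs_summable_harm a b : abs_summable (fun k => harm k * a k) (fun k => harm k * b k) ->
  abs_summable a b.
Proof.
apply: abs_summable_le => k; have h1 := harm_ge1 k.
have h0 : 0 <= harm k by lra.
by rewrite !normrM ger0_norm// -mulrDr ler_peMl// addr_ge0.
Qed.

End WeakDerivatives.

(** * The conjugate Dirichlet kernel *)

Section Hilbert.
Context {R : realType}.
Implicit Types (f g : R -> R) (a b : nat -> R) (k n : nat) (x u eps : R).
Local Notation mu := (@lebesgue_measure R).
Local Notation circle := `[- (pi : R), pi]%classic.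

(** The kernel [1 / tan (u / 2)], written as a quotient whose continuity at odd
    multiples of [pi] is visible. *)
Definition cothalf u : R := cos (u / 2) / sin (u / 2).

(** Where the cosine or the sine vanishes, both sides are 0 by the convention on division. *)
Lemma divr_tanE (c u : R) : c / tan (u / 2) = c * cothalf u.
Proof. by rewrite /tan invf_div. Qed.

Lemma cothalfN u : cothalf (- u) = - cothalf u.
Proof. by rewrite /cothalf mulNr cosN sinN invrN mulrN. Qed.

Lemma sin_half_gt0 u : 0 < u <= pi -> 0 < sin (u / 2).
Proof.
move=> /andP[u0 upi]; apply: sin_gt0_pi.
by apply/andP; split; have := pi_gt0 R; lra.
Qed.

Lemma continuous_cothalf u : sin (u / 2) != 0 -> {for u, continuous cothalf}.
Proof.
move=> s0; have ch : {for u, continuous (fun t : R => t / 2)} by exact: mulrr_continuous.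
apply: cvgM; first by apply: continuous_comp; [exact: ch|exact: continuous_cos].
by apply: cvgV => //; apply: continuous_comp; [exact: ch|exact: continuous_sin].
Qed.

Lemma cothalf_le u eps : 0 < eps -> eps <= `|u| <= pi ->
  `|cothalf u| <= (sin (eps / 2))^-1.
Proof.
move=> e0 /andP[eu upi].
have p0 := pi_gt0 R.
have se : 0 < sin (eps / 2) by apply: sin_half_gt0; lra.
rewrite /cothalf normrM normfV.
have -> : `|sin (u / 2)| = sin (`|u| / 2).
  have [u0|u0] := ger0P u.
    by rewrite ger0_norm// sin_ge0_pi//; move: upi; rewrite ger0_norm// => ?; lra.
  move: upi; rewrite ltr0_norm// => ?.
  rewrite -normrN -sinN ger0_norm; first by rewrite mulNr.
  by rewrite sin_ge0_pi//; lra.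
have su : sin (eps / 2) <= sin (`|u| / 2).
  have [->//|ne] := eqVneq eps `|u|.
  have lt_eu : eps < `|u| by rewrite lt_neqAle ne.
  by apply: ltW; rewrite ltr_sin ?in_itv/=; lra.
rewrite -[leRHS]mul1r ler_pM ?invr_ge0 ?cos_max//; first by lra.
by rewrite lef_pV2// posrE; lra.
Qed.

(** The sum [1 + 2 * (cos u + ... + cos (k u)) + cos ((k + 1) u)], that is, the
    conjugate Dirichlet kernel [sin ((k + 1) u) / tan (u / 2)] freed of its
    removable singularity. *)
Fixpoint conj_kernel k u : R :=
  if k is k'.+1 then conj_kernel k' u + (cosk k' u + cosk k'.+1 u) else 1 + cosk 0 u.

(** The primitive of [conj_kernel k] that vanishes at 0. *)
Fixpoint conj_prim k u : R :=
  if k is k'.+1 then conj_prim k' u + (sink k' u / k'.+1%:R + sink k'.+1 u / k'.+2%:R)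
  else u + sink 0 u.

(** Passing from [k] to [k + 1] adds
    [(sin ((k + 2) u) - sin ((k + 1) u)) * cothalf u], and the difference of
    sines has a factor [sin (u / 2)] that cancels the denominator. *)
Lemma conj_kernelE k u : sin (u / 2) != 0 -> sink k u * cothalf u = conj_kernel k u.
Proof.
move=> s0; elim: k => [|k IH].
  rewrite /= /sink /cosk /cothalf.
  have -> : 1%:R * u = u / 2 + u / 2 by field.
  move: (u / 2) s0 => v s0; rewrite sinD cosD.
  transitivity ((cos v ^+ 2 + sin v ^+ 2) + (cos v * cos v - sin v * sin v)).
    by field.
  by rewrite cos2Dsin2.
rewrite /= -IH /sink /cosk /cothalf.
have -> : k.+2%:R * u = (k.+1%:R * u + u / 2) + u / 2.
  by rewrite -[k.+2%:R]natr1; field.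
have -> : k.+1%:R * u = (k.+1%:R * u + u / 2) - u / 2 by ring.
have -> : k.+1%:R * u + u / 2 - u / 2 + u / 2 = k.+1%:R * u + u / 2 by ring.
move: (u / 2) s0 (k.+1%:R * u + u / 2) => B s0 A.
by rewrite (sinD A B) (cosD A B) (sinB A B) (cosB A B); field.
Qed.

Lemma is_derive_conj_prim k u : is_derive u (1 : R) (conj_prim k) (conj_kernel k u).
Proof.
have ds j t : is_derive t (1 : R) (fun t => sink j t / j.+1%:R) (cosk j t).
  have d := is_derive_sinM j.+1%:R t.
  have -> : (fun t => sink j t / j.+1%:R) = j.+1%:R^-1 \*: (fun t : R => sin (j.+1%:R * t)).
    by apply/funext => y; rewrite /= mulrC.
  apply: is_derive_eq; rewrite /GRing.scale/= mulKf//.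
elim: k => [|k IH].
  have d := ds 0 u.
  have -> : conj_prim 0 = (@idfun R) + (fun t => sink 0 t / 1).
    by apply/funext => t; rewrite /= fctE divr1.
  by apply: is_derive_eq.
have d1 := ds k u; have d2 := ds k.+1 u.
have -> : conj_prim k.+1 = conj_prim k +
    ((fun t => sink k t / k.+1%:R) + (fun t => sink k.+1 t / k.+2%:R)) by [].
by apply: is_derive_eq.
Qed.

Lemma continuous_conj_kernel k : continuous (conj_kernel k).
Proof.
elim: k => [|k IH] u /=.
  by apply: cvgD; [exact: cvg_cst|exact: continuous_cosk].
apply: cvgD; first exact: IH.
by apply: cvgD; exact: continuous_cosk.
Qed.

Lemma conj_prim_pi k : conj_prim k pi = pi.
Proof.
have sp j : sink j pi = 0.
  rewrite /sink; elim: j => [|j IH]; first by rewrite mul1r sinpi.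
  by rewrite -natr1 mulrDl mul1r sinDpi IH oppr0.
by elim: k => [|k IH]; rewrite /= ?IH !sp ?mul0r !addr0.
Qed.

Lemma conj_prim0 k : conj_prim k 0 = 0.
Proof.
have s0 j : sink j (0 : R) = 0 by rewrite /sink mulr0 sin0.
by elim: k => [|k IH]; rewrite /= ?IH !s0 ?mul0r !addr0.
Qed.

Lemma continuous_conj_prim k : continuous (conj_prim k).
Proof.
move=> u; apply: differentiable_continuous; apply/derivable1_diffP.
by have [] := is_derive_conj_prim k u.
Qed.

(** Bounding every sine by 1 leaves twice the harmonic number, the last term
    being counted once. *)
Lemma conj_prim_le k u : `|conj_prim k u| <= `|u| + 2 * @harm R k.
Proof.
have sj j : `|sink j u / j.+1%:R| <= j.+1%:R^-1.
  by rewrite normrM normfV normr_nat ler_piMl ?invr_ge0//; exact: sin_max.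
have hS j : @harm R j.+1 = @harm R j + j.+2%:R^-1 by rewrite /harm big_nat_recr.
(* the last sine occurs once and not twice; this slack feeds the induction *)
suff : `|conj_prim k u| <= `|u| + 2 * @harm R k - k.+1%:R^-1.
  by move/le_trans; apply; rewrite gerBl invr_ge0.
elim: k => [|k IH] /=.
  rewrite /harm big_nat1 invr1; apply: le_trans (ler_normD _ _) _.
  by have := sj 0; rewrite divr1 invr1; lra.
apply: le_trans (ler_normD _ _) _.
apply: le_trans (lerD IH (ler_normD _ _)) _.
apply: le_trans (lerD (lexx _) (lerD (sj k) (sj k.+1))) _.
by rewrite hS; move: (k.+1%:R^-1) (k.+2%:R^-1) => p q; lra.
Qed.
End Hilbert.

(** * The Hilbert transform of a trigonometric series *)

Section HilbertSeries.
Context {R : realType}.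
Implicit Types (f g : R -> R) (a b : nat -> R) (k n : nat) (x u eps : R).
Local Notation mu := (@lebesgue_measure R).
Local Notation circle := `[- (pi : R), pi]%classic.

Lemma Rintegral_reflect g x (c d : R) : c < d ->
  {within `[x - d, x - c], continuous g} ->
  \int[mu]_(t in `[x - d, x - c]) g t = \int[mu]_(u in `[c, d]) g (x - u).
Proof.
move=> cd cg.
have D (y : R) : is_derive y (1 : R) (fun u => x - u) (-1).
  have -> : (fun u => x - u) = cst x - (@idfun R) by [].
  by apply: is_derive_eq; rewrite sub0r.
have D1 : derive1 (fun u : R => x - u) = cst (-1).
  by apply/funext => y; rewrite derive1E; have d1 := D y; rewrite derive_val.
have cF : continuous (fun u : R => x - u).
  by move=> y; apply: cvgB; [exact: cvg_cst|exact: cvg_id].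
rewrite /Rintegral (@integration_by_substitution_decreasing R (fun u => x - u)).
- congr fine; apply: eq_integral => y _; congr EFin.
  by rewrite fctE D1 /= opprK mulr1.
- exact: ltW.
- by move=> y z _ _ yz; rewrite ltrD2l ltrN2.
- by move=> y _; rewrite D1; exact: cvg_cst.
- by rewrite D1; exact: is_cvg_cst.
- by rewrite D1; exact: is_cvg_cst.
- split; [by move=> y _; have [] := D y|exact: cvg_at_right_filter (cF c)|
          exact: cvg_at_left_filter (cF d)].
- exact: cg.
Qed.

Lemma Rintegral_translate g x (c d : R) : c < d ->
  {within `[x + c, x + d], continuous g} ->
  \int[mu]_(t in `[x + c, x + d]) g t = \int[mu]_(u in `[c, d]) g (x + u).
Proof.
move=> cd cg.
have D (y : R) : is_derive y (1 : R) (fun u => x + u) 1.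
  have -> : (fun u => x + u) = cst x + (@idfun R) by [].
  by apply: is_derive_eq; rewrite add0r.
have D1 : derive1 (fun u : R => x + u) = cst 1.
  by apply/funext => y; rewrite derive1E; have d1 := D y; rewrite derive_val.
have cF : continuous (fun u : R => x + u).
  by move=> y; apply: cvgD; [exact: cvg_cst|exact: cvg_id].
rewrite /Rintegral (@integration_by_substitution_increasing R (fun u => x + u)).
- congr fine; apply: eq_integral => y _; congr EFin.
  by rewrite fctE D1 /= mulr1.
- exact: ltW.
- by move=> y z _ _ yz; rewrite ltrD2l.
- by move=> y _; rewrite D1; exact: cvg_cst.
- by rewrite D1; exact: is_cvg_cst.
- by rewrite D1; exact: is_cvg_cst.
- split; [by move=> y _; have [] := D y|exact: cvg_at_right_filter (cF c)|
          exact: cvg_at_left_filter (cF d)].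
- exact: cg.
Qed.

Definition trunc_dom x eps : set R := `[x - pi, x - eps] `|` `[x + eps, x + pi].

Lemma measurable_trunc_dom x eps : measurable (trunc_dom x eps).
Proof. by apply: measurableU; exact: measurable_itv. Qed.

Lemma hilbert_truncE f x eps : hilbert_trunc f x eps =
  (\int[mu]_(t in trunc_dom x eps) (cothalf (x - t) * f t)) / (2 * pi).
Proof.
rewrite /hilbert_trunc; congr (_ / _); apply: eq_Rintegral => t _.
by rewrite divr_tanE mulrC.
Qed.

Lemma trunc_domP x eps t : 0 < eps <= pi -> trunc_dom x eps t -> eps <= `|x - t| <= pi.
Proof.
move=> /andP[e0 epi] [] /=; rewrite in_itv/= => /andP[t1 t2].
  by rewrite ger0_norm; lra.
by rewrite ler0_norm; lra.
Qed.

Lemma sin_half_neq0 u : 0 < `|u| <= pi -> sin (u / 2) != 0.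
Proof.
move=> u0; have := sin_half_gt0 u0.
have [_|_] := ger0P u; first by move/gt_eqF ->.
by rewrite mulNr sinN oppr_gt0 => /lt_eqF ->.
Qed.

Lemma continuous_cothalf_sub x t : sin ((x - t) / 2) != 0 ->
  {for t, continuous (fun t => cothalf (x - t))}.
Proof.
move=> s0; apply: (@continuous_comp _ _ _ (fun t => x - t) cothalf).
  by apply: cvgB; [exact: cvg_cst|exact: cvg_id].
exact: continuous_cothalf.
Qed.

Lemma within_cothalf x eps (c d : R) : 0 < eps <= pi ->
  `[c, d] `<=` trunc_dom x eps ->
  {within `[c, d], continuous (fun t => cothalf (x - t))}.
Proof.
move=> e0 cd; apply: continuous_in_subspaceT => t; rewrite inE => /cd tE.
apply: continuous_cothalf_sub; apply: sin_half_neq0.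
by have := trunc_domP e0 tE; move: e0; lra.
Qed.

Lemma integrable_trunc x eps : 0 < eps <= pi ->
  integrable_on (trunc_dom x eps) (fun t => cothalf (x - t)).
Proof.
move=> e0; have /andP[e0' _] := e0.
apply: (@integrable_on_bounded _ _ _ _ _ _ (sin (eps / 2))^-1).
- exact: measurable_trunc_dom.
- pose A := `[(x - pi)%R, (x - eps)%R]%classic; pose B := `[(x + eps)%R, (x + pi)%R]%classic.
  apply: (@le_lt_trans _ _ (mu A + mu B)%E).
    by apply: measureU2; exact: measurable_itv.
  by rewrite /A /B lte_add_pinfty// lebesgue_measure_itv/=; case: ifP => _;
    rewrite ?ltry// -EFinB ltry.
- apply/measurable_funU; [exact: measurable_itv|exact: measurable_itv|split];
    apply: subspace_continuous_measurable_fun; try exact: measurable_itv;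
    apply: (within_cothalf e0) => t; [by left|by right].
- by move=> t tE; apply: cothalf_le => //; exact: trunc_domP tE.
Qed.

(** The substitutions [t = x - u] and [t = x + u] bring both halves of the domain
    to [[eps, pi]], where the oddness of the kernel turns their sum into an
    integral of the difference [g (x - u) - g (x + u)]. *)
Lemma Rintegral_trunc_odd g x eps : 0 < eps < pi -> continuous g ->
  (forall t, `|g t| <= 1) ->
  \int[mu]_(t in trunc_dom x eps) (cothalf (x - t) * g t) =
  \int[mu]_(u in `[eps, pi]) ((g (x - u) - g (x + u)) * cothalf u).
Proof.
move=> /andP[e0 epi] cg g1; have e0' : 0 < eps <= pi by rewrite e0 ltW.
have mE := measurable_trunc_dom x eps.
pose h t := cothalf (x - t) * g t.
have Ih : integrable_on (trunc_dom x eps) h.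
  apply: (integrable_on_mul (M := 1)) => //; first exact: integrable_trunc.
  by apply: measurable_funTS; exact: continuous_measurable_fun.
have wc (c d : R) : `[c, d] `<=` trunc_dom x eps -> {within `[c, d], continuous h}.
  move=> cd; have := within_cothalf e0' cd => wk t.
  by apply: cvgM; [exact: wk|exact: continuous_subspaceT].
have dis : [disjoint `[x - pi, x - eps]%classic & `[x + eps, x + pi]%classic].
  apply/disj_setPS => t [] /=; rewrite !in_itv/= => /andP[_ t1] /andP[t2 _].
  by exfalso; lra.
rewrite Rintegral_setU//; try exact: measurable_itv.
have s1 : `[x - pi, x - eps] `<=` trunc_dom x eps by left.
have s2 : `[x + eps, x + pi] `<=` trunc_dom x eps by right.
rewrite (Rintegral_reflect epi (wc _ _ s1)) (Rintegral_translate epi (wc _ _ s2)).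
have Ik (F : R -> R) : continuous F -> integrable_on `[eps, pi] (fun u => cothalf u * F u).
  move=> cF; apply: continuous_compact_integrable; first exact: segment_compact.
  apply: continuous_in_subspaceT => t; rewrite inE/= in_itv/= => /andP[t1 t2].
  apply: cvgM; last exact: cF.
  by apply: continuous_cothalf; apply: sin_half_neq0; rewrite ger0_norm; lra.
rewrite (_ : (fun u => h (x - u)) = fun u => cothalf u * g (x - u)); last first.
  by apply/funext => u; rewrite /h; congr (cothalf _ * _); ring.
rewrite (_ : (fun u => h (x + u)) = fun u => cothalf u * (- g (x + u))); last first.
  apply/funext => u; rewrite /h (_ : x - (x + u) = - u); last by ring.
  by rewrite cothalfN mulNr mulrN.
rewrite -RintegralD; first by apply: eq_Rintegral => u _; ring.
- exact: measurable_itv.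
- apply: Ik => t; apply: continuous_comp; last exact: cg.
  by apply: cvgB; [exact: cvg_cst|exact: cvg_id].
- apply: Ik => t; apply: cvgN; apply: continuous_comp; last exact: cg.
  by apply: cvgD; [exact: cvg_cst|exact: cvg_id].
Qed.

Lemma Rintegral_conj_kernel k (c eps : R) : 0 < eps < pi ->
  \int[mu]_(u in `[eps, pi]) (c * (sink k u * cothalf u)) = c * (pi - conj_prim k eps).
Proof.
move=> /andP[e0 epi].
transitivity (\int[mu]_(u in `[eps, pi]) (c * conj_kernel k u)).
  apply: eq_Rintegral => u; rewrite inE/= in_itv/= => /andP[u1 u2].
  by rewrite conj_kernelE//; apply: sin_half_neq0; rewrite ger0_norm; lra.
rewrite RintegralZl; last 2 first.
- exact: measurable_itv.
- by apply: integrable_on_cont; exact: continuous_conj_kernel.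
congr (_ * _); rewrite -{2}(conj_prim_pi k); apply: Rintegral_derivative; first exact: ltW.
- by move=> u; exact: is_derive_conj_prim.
- exact: continuous_conj_kernel.
Qed.

Lemma Rintegral_trunc_cosk k x eps : 0 < eps < pi ->
  \int[mu]_(t in trunc_dom x eps) (cosk k t * cothalf (x - t)) =
  2 * sink k x * (pi - conj_prim k eps).
Proof.
move=> e0; rewrite -Rintegral_conj_kernel//.
under eq_Rintegral do rewrite mulrC.
rewrite Rintegral_trunc_odd//; [|exact: continuous_cosk|by move=> t; exact: cos_max].
apply: eq_Rintegral => u _; rewrite mulrA; congr (_ * _).
by rewrite /cosk /sink mulrBr mulrDr cosB cosD; ring.
Qed.

Lemma Rintegral_trunc_sink k x eps : 0 < eps < pi ->
  \int[mu]_(t in trunc_dom x eps) (sink k t * cothalf (x - t)) =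
  - 2 * cosk k x * (pi - conj_prim k eps).
Proof.
move=> e0; rewrite -Rintegral_conj_kernel//.
under eq_Rintegral do rewrite mulrC.
rewrite Rintegral_trunc_odd//; [|exact: continuous_sink|by move=> t; exact: sin_max].
apply: eq_Rintegral => u _; rewrite mulrA; congr (_ * _).
by rewrite /cosk /sink mulrBr mulrDr sinB sinD; ring.
Qed.

(** Truncated at [eps], the transform of the mode of index [k] is, up to sign, the
    conjugate mode times this factor. *)
Definition conj_mult k eps : R := 1 - conj_prim k eps / pi.

(** Away from the singularity the kernel is integrable, so that the series may be
    integrated against it termwise. *)
Lemma hilbert_trunc_trig_sum a b f x eps : abs_summable a b ->
  measurable_fun setT f -> ae_eq mu setT f (trig_sum a b) -> 0 < eps < pi ->
  hilbert_trunc f x eps =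
  limn (series (fun k => (a k * sink k x - b k * cosk k x) * conj_mult k eps)).
Proof.
move=> ab mf fS e0; have /andP[e1 e2] := e0.
have e0' : 0 < eps <= pi by rewrite e1 ltW.
have mE := measurable_trunc_dom x eps.
have IK := integrable_trunc x e0'.
have mK := measurable_on_integrable IK.
have [_ cv] := cvg_Rintegral_trig_sum ab mE IK.
rewrite hilbert_truncE (@Rintegral_ae_eq _ _ _
  (fun t => trig_sum a b t * cothalf (x - t))) //; first last.
- by apply: filterS fS => t /= /(_ I) -> _; rewrite mulrC.
- apply: measurable_funM => //.
  by apply: measurable_funTS; exact: measurable_trig_sum.
- by apply: measurable_funM => //; exact: measurable_funTS.
move: cv => /(cvgM (cvg_cst (2 * pi)^-1)) /(cvg_lim (@Rhausdorff R)).
rewrite [_ / _]mulrC => <-.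
congr (limn _); apply/funext => n; rewrite /series/= big_distrr/=.
apply: eq_bigr => k _; rewrite Rintegral_trunc_cosk// Rintegral_trunc_sink//.
have p0 : (pi : R) != 0 by rewrite gt_eqF// pi_gt0.
by rewrite /conj_mult; move: (pi : R) p0 => p p0; field.
Qed.

Lemma series_tail_le (v m : nat -> R) n : cvgn (series m) ->
  (forall k, `|v k| <= m k) ->
  cvgn (series v) /\ `|limn (series v) - series v n| <= limn (series m) - series m n.
Proof.
move=> cm vm; have cv : cvgn (series v).
  apply: normed_cvg; apply: series_le_cvg cm => k //=; first exact: le_trans (vm k).
split => //.
have cd : `|series v p - series v n| @[p --> \oo] --> `|limn (series v) - series v n|.
  by apply: cvg_norm; apply: cvgB => //; exact: cvg_cst.
have ce : series m p - series m n @[p --> \oo] --> limn (series m) - series m n.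
  by apply: cvgB => //; exact: cvg_cst.
apply: (ler_cvg_to cd ce); near=> p.
have np : (n <= p)%N by near: p; exact: nbhs_infty_ge.
rewrite !sub_series_geq//; apply: le_trans (ler_norm_sum _ _ _) _.
by apply: ler_sum => k _; exact: vm.
Unshelve. all: by end_near. Qed.

(** Split both series at an index beyond which the sum of the bounds is small;
    the finite parts converge term by term. *)
Lemma tannery (T : Type) (F : set_system T) (FF : ProperFilter F)
    (u : nat -> T -> R) (l m : nat -> R) :
  cvgn (series m) -> (\forall e \near F, forall k, `|u k e| <= m k) ->
  (forall k, u k e @[e --> F] --> l k) ->
  limn (series (u^~ e)) @[e --> F] --> limn (series l).
Proof.
move=> cm um ul.
have lm k : `|l k| <= m k.
  have ll := cvg_norm (ul k).
  apply: (cvgr_to_le (ll _)); near=> e.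
  by have /(_ k) : forall k, `|u k e| <= m k by near: e.
apply/cvgrPdist_le => eta eta0.
(* the tails of both series and the finite part get a third of [eta] each *)
have [N HN] : exists N, limn (series m) - series m N <= eta / 3.
  have /cvgrPdist_le /(_ (eta / 3)) : series m @ \oo --> limn (series m) by [].
  have e3 : 0 < eta / 3 by lra.
  move=> /(_ e3) [N _ HN]; exists N; have := HN N (leqnn N).
  exact: le_trans (ler_norm _).
have cN : series (u^~ e) N @[e --> F] --> series l N.
  rewrite /series/=; elim: (N) => [|p IH].
    rewrite big_geq//; under eq_fun do rewrite big_geq//; exact: cvg_cst.
  rewrite big_nat_recr//=; under eq_fun do rewrite big_nat_recr//=.
  by apply: cvgD; [exact: IH|exact: ul].
have e3 : 0 < eta / 3 by lra.
have := cN => /cvgrPdist_le /(_ _ e3) cN3.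
near=> e.
have ue : forall k, `|u k e| <= m k by near: e.
have [_ t1] := series_tail_le N cm ue.
have [_ t2] := series_tail_le N cm lm.
have t3 : `|series l N - series (u^~ e) N| <= eta / 3 by near: e.
have -> : limn (series l) - limn (series (u^~ e)) =
  (limn (series l) - series l N) + (series l N - series (u^~ e) N)
   - (limn (series (u^~ e)) - series (u^~ e) N) by ring.
apply: le_trans (ler_normB _ _) _.
apply: le_trans (lerD (ler_normD _ _) (lexx _)) _.
by lra.
Unshelve. all: by end_near. Qed.

(** Tannery's theorem, with bounds given by the harmonic weights, lets [eps] tend
    to 0 in the series of the truncated transforms; each factor
    [conj_mult k eps] tends to 1 because [conj_prim k] vanishes at 0. *)
Lemma hilbert_trig_sum a b f x : abs_summable (fun k => harm k * a k) (fun k => harm k * b k) ->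
  measurable_fun setT f -> ae_eq mu setT f (trig_sum a b) ->
  hilbert f x = trig_sum b (fun k => - a k) x.
Proof.
move=> hab mf fS; have ab := abs_summable_harm hab.
have p0 := pi_gt0 R.
pose u k eps := (a k * sink k x - b k * cosk k x) * conj_mult k eps.
pose l k := a k * sink k x - b k * cosk k x.
have H : limn (series (u^~ e)) @[e --> 0^'+] --> limn (series l).
  apply: (@tannery R (0^'+) _ u l (fun k => 4 * (`|harm k * a k| + `|harm k * b k|))).
  - exact: (@is_cvg_seriesZ R (fun k => `|harm k * a k| + `|harm k * b k|) 4).
  - near=> eps => k.
    have e0 : 0 < eps by near: eps; exact: nbhs_right_gt.
    have ep : eps < pi by near: eps; exact: nbhs_right_lt.
    have h1 := @harm_ge1 R k.
    have cm : `|conj_mult k eps| <= 4 * harm k.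
      have := conj_prim_le k eps; rewrite (gtr0_norm e0) => c1.
      rewrite /conj_mult; apply: le_trans (ler_normB _ _) _.
      rewrite normr1 normrM normfV (gtr0_norm p0).
      have : `|conj_prim k eps| / pi <= 1 + 2 * harm k.
        rewrite ler_pdivrMr//; apply: le_trans c1 _.
        have : 1 <= pi :> R by have := pi_ge2 R; lra.
        by nra.
      by lra.
    have l1 : `|a k * sink k x - b k * cosk k x| <= `|a k| + `|b k|.
      apply: le_trans (ler_normB _ _) _.
      by apply: lerD; rewrite normrM ler_piMr//; [exact: sin_max|exact: cos_max].
    rewrite /u normrM; apply: le_trans (ler_pM _ _ l1 cm) _ => //.
    by rewrite !normrM (ger0_norm (le_trans ler01 h1)); lra.
  - move=> k; rewrite /u /l -[X in _ --> X]mulr1; apply: cvgM; first exact: cvg_cst.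
    rewrite -[X in _ --> X]subr0; apply: cvgB; first exact: cvg_cst.
    rewrite -[X in _ --> X](mul0r pi^-1); apply: cvgM; last exact: cvg_cst.
    rewrite -[X in _ --> X](conj_prim0 k); apply: cvg_at_right_filter; exact: continuous_conj_prim.
rewrite /hilbert.
have -> : lim (hilbert_trunc f x eps @[eps --> 0^'+]) = limn (series l).
  apply/(cvg_lim (@Rhausdorff R)); apply: cvg_trans H; apply: near_eq_cvg.
  near=> eps; rewrite (@hilbert_trunc_trig_sum a b)//; apply/andP; split.
    by near: eps; exact: nbhs_right_gt.
  by near: eps; exact: nbhs_right_lt.
rewrite /trig_sum -limN; last first.
  have [] := @series_tail_le l _ 0 ab _ => // k.
  apply: le_trans (ler_normB _ _) _.
  by apply: lerD; rewrite normrM ler_piMr//; [exact: sin_max|exact: cos_max].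
congr (limn _); rewrite -seriesN; congr series; apply/funext => k.
by rewrite /l /trig_term fctE; ring.
Unshelve. all: by end_near. Qed.
End HilbertSeries.

(** * The operator and its inverse *)

Section Resolvent.
Context {R : realType}.
Implicit Types (f g phi psi : R -> R) (a b : nat -> R) (k n : nat) (beta x : R).
Local Notation mu := (@lebesgue_measure R).
Local Notation circle := `[- (pi : R), pi]%classic.

Lemma wderivP f : H1 f -> L2 (wderiv f) /\ is_weak_derivative f (wderiv f).
Proof.
move=> [_ ex].
exact: (@xgetPex _ (fun=> 0) [set g | L2 g /\ is_weak_derivative f g]).
Qed.

(** A function with a square-integrable weak derivative satisfies the weighted
    summability required by [hilbert_trig_sum]. *)
Lemma hilbert_weak f g : L2 f -> mean f = 0 -> L2 g -> is_weak_derivative f g ->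
  abs_summable (fun k => 2 * fsin f k) (fun k => - (2 * fcos f k)) /\
  hilbert f = trig_sum (fun k => 2 * fsin f k) (fun k => - (2 * fcos f k)).
Proof.
move=> Lf f0 Lg fg; have hs := coef_weak_summable Lf Lg fg.
have [_ mf _] := Lf.
have s1 := abs_summable_harm hs.
have s2 := @abs_summable_scale _ _ _ 2 hs.
split.
  have := @abs_summable_scale _ _ _ 2 s1; apply: abs_summable_le => k.
  by rewrite normrN addrC.
apply/funext => x; apply: hilbert_trig_sum => //; last exact: fourier_inversion.
apply: abs_summable_le s2 => k; rewrite le_eqVlt; apply/orP; left; apply/eqP.
by rewrite !(mulrCA 2).
Qed.

Lemma fcos_add f g k : integrable_on circle f -> integrable_on circle g ->
  fcos (fun x => f x + g x) k = fcos f k + fcos g k.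
Proof.
move=> If Ig; rewrite /fcos -mean_add; [|exact: integrable_on_mul_cosk..].
by congr mean; apply/funext => x; rewrite mulrDl.
Qed.

Lemma fsin_add f g k : integrable_on circle f -> integrable_on circle g ->
  fsin (fun x => f x + g x) k = fsin f k + fsin g k.
Proof.
move=> If Ig; rewrite /fsin -mean_add; [|exact: integrable_on_mul_sink..].
by congr mean; apply/funext => x; rewrite mulrDl.
Qed.

Lemma fcos_scale c f k : integrable_on circle f ->
  fcos (fun x => c * f x) k = c * fcos f k.
Proof.
move=> If; rewrite /fcos -mean_scale; last exact: integrable_on_mul_cosk.
by congr mean; apply/funext => x; rewrite mulrA.
Qed.

Lemma fsin_scale c f k : integrable_on circle f ->
  fsin (fun x => c * f x) k = c * fsin f k.
Proof.
move=> If; rewrite /fsin -mean_scale; last exact: integrable_on_mul_sink.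
by congr mean; apply/funext => x; rewrite mulrA.
Qed.

(** The second derivative and the Hilbert transform both send the coefficients of
    [wderiv phi] to multiples of the conjugate ones, by the factors [k + 1] and
    1 respectively. *)
Lemma Lop_spectrum beta phi : H1 phi -> H1 (wderiv phi) ->
  [/\ periodic (Lop beta phi) (2 * pi), measurable_fun setT (Lop beta phi),
      integrable_on circle (Lop beta phi) & mean (Lop beta phi) = 0] /\
  forall k, fcos (Lop beta phi) k = - ((k.+1%:R + beta) * fsin (wderiv phi) k) /\
            fsin (Lop beta phi) k = (k.+1%:R + beta) * fcos (wderiv phi) k.
Proof.
move=> Hphi Hf; have [_ wf] := wderivP Hphi; have [Lg wg] := wderivP Hf.
have [Lf _] := Hf; have f0 := mean_weak wf; have g0 := mean_weak wg.
move: Lf wg Lg f0 g0 {Hf wf}; rewrite /Lop.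
move: (wderiv phi) => f; move: (wderiv f) => g Lf wg Lg f0 g0.
have [sH HE] := hilbert_weak Lf f0 Lg wg; rewrite HE.
set S := trig_sum _ _; have [pg mg _] := Lg.
have IS : integrable_on circle S := integrable_trig_sum sH.
have mS : measurable_fun setT S := measurable_trig_sum sH.
have mc : measurable circle by exact: measurable_itv.
have Ig := L2_integrable Lg.
have Ib : integrable_on circle (fun x => beta * S x) by exact: integrable_on_scale.
have Is : integrable_on circle (fun x => g x + beta * S x) := integrable_on_add mc Ig Ib.
have -> : (fun x => - (g x + beta * S x)) = fun x => (-1) * (g x + beta * S x).
  by apply/funext => x; rewrite mulN1r.
split; first split.
- by move=> x; rewrite pg /S periodic_trig_sum.
- apply: measurable_funM => //; apply: measurable_funD => //.
  exact: measurable_funM.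
- exact: integrable_on_scale.
- by rewrite mean_scale// mean_add// mean_scale// /S mean_trig_sum// g0 mulr0 addr0 mulr0.
move=> k; rewrite fcos_scale// fsin_scale// fcos_add// fsin_add// fcos_scale// fsin_scale//.
rewrite /S fcos_trig_sum// fsin_trig_sum// (fcos_weak k Lf wg) (fsin_weak k Lf wg).
by split; field.
Qed.

Lemma fcos_ae_eq f g k : measurable_fun setT f -> measurable_fun setT g ->
  ae_eq mu setT f g -> fcos f k = fcos g k.
Proof.
move=> mf mg fg; apply: mean_ae_eq.
- by apply: measurable_funM => //; exact: measurable_cosk.
- by apply: measurable_funM => //; exact: measurable_cosk.
- by apply: filterS fg => x /= H /H ->.
Qed.

Lemma fsin_ae_eq f g k : measurable_fun setT f -> measurable_fun setT g ->
  ae_eq mu setT f g -> fsin f k = fsin g k.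
Proof.
move=> mf mg fg; apply: mean_ae_eq.
- by apply: measurable_funM => //; exact: measurable_sink.
- by apply: measurable_funM => //; exact: measurable_sink.
- by apply: filterS fg => x /= H /H ->.
Qed.

(** Tested against the modes, the weak derivative has prescribed coefficients. *)
Lemma weak_derivative_unique f g h : L2 f -> L2 g -> L2 h ->
  is_weak_derivative f g -> is_weak_derivative f h -> ae_eq mu setT g h.
Proof.
move=> Lf Lg Lh fg fh; have [pg _ _] := Lg; have [ph _ _] := Lh.
apply: trig_coef_unique => //; try exact: L2_integrable.
- by rewrite (mean_weak fg) (mean_weak fh).
- by move=> k; rewrite (fcos_weak k Lf fg) (fcos_weak k Lf fh).
- by move=> k; rewrite (fsin_weak k Lf fg) (fsin_weak k Lf fh).
Qed.

(** Only integrals of the function against test functions are involved. *)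
Lemma is_weak_derivative_ae f1 f2 g : measurable_fun setT f1 -> measurable_fun setT f2 ->
  ae_eq mu setT f1 f2 -> is_weak_derivative f1 g -> is_weak_derivative f2 g.
Proof.
move=> m1 m2 f12 w chi tc; rewrite -(w chi tc).
have mc : measurable_fun setT (derive1 chi).
  by apply: continuous_measurable_fun; exact: continuous_derive1_test.
apply: mean_ae_eq.
- exact: measurable_funM.
- exact: measurable_funM.
- by apply: filterS f12 => x /= H /H ->.
Qed.

(** The coefficients of the solution are those of [psi] divided by
    [c * (c + beta)], where [c] is the frequency.  Differentiating twice
    multiplies them by [c ^ 2], which leaves them bounded by those of [psi] and
    hence absolutely summable; the first and second weak derivatives are
    therefore explicit series. *)
Lemma Lop_surjective beta psi : 0 < beta -> Hspace psi ->
  exists phi, Ldom beta phi /\ ae_eq mu setT (Lop beta phi) psi.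
Proof.
move=> b0 Hpsi; have [H1psi psi0] := Hpsi; have [Lpsi _] := H1psi.
have [Lpsi' wpsi] := wderivP H1psi.
have sp := abs_summable_harm (coef_weak_summable Lpsi Lpsi' wpsi).
pose c k : R := k.+1%:R.
have c1 k : 1 <= c k by rewrite /c ler1n.
have cb k : c k + beta != 0 by rewrite gt_eqF//; have := c1 k; lra.
have c0 k : c k != 0 by rewrite gt_eqF//; have := c1 k; lra.
pose a k := 2 * fcos psi k / (c k * (c k + beta)).
pose b k := 2 * fsin psi k / (c k * (c k + beta)).
(* the three coefficient sequences below are those of [psi] multiplied by
   factors between 0 and 2 *)
have sum2 (s : nat -> R) (u v : nat -> R) : (forall k, 0 <= s k <= 2) ->
    (forall k, `|u k| + `|v k| = s k * (`|fcos psi k| + `|fsin psi k|)) ->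
    abs_summable u v.
  move=> s2 uv.
  have := @is_cvg_seriesZ R (fun k => `|fcos psi k| + `|fsin psi k|) 2 sp.
  apply: abs_summable_le => k; rewrite uv.
  by apply: ler_wpM2r; [rewrite addr_ge0|have /andP[] := s2 k].
have nrm (s t : R) : 0 <= s -> `|s * t| = s * `|t|.
  by move=> s0; rewrite normrM ger0_norm.
have s0 : abs_summable a b.
  apply: (sum2 (fun k => 2 / (c k * (c k + beta)))).
    move=> k; have := c1 k => ck; rewrite divr_ge0//=; last by nra.
    by rewrite ler_pdivrMr; nra.
  move=> k; have s0 : 0 <= 2 / (c k * (c k + beta)).
    by have := c1 k => ck; rewrite divr_ge0//; nra.
  by rewrite /a /b [RHS]mulrDr -!nrm//; congr (_ + _); congr (Num.norm _); ring.
have s1 : abs_summable (fun k => c k * b k) (fun k => - (c k * a k)).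
  apply: (sum2 (fun k => 2 / (c k + beta))).
    move=> k; have := c1 k => ck; rewrite divr_ge0//=; last by lra.
    by rewrite ler_pdivrMr; lra.
  move=> k; have s1 : 0 <= 2 / (c k + beta).
    by have := c1 k => ck; rewrite divr_ge0//; lra.
  rewrite normrN addrC [RHS]mulrDr -!nrm//; rewrite /a /b.
  have := cb k; have := c0 k; move: (c k) => C C0 Cb.
  by congr (_ + _); congr (Num.norm _); field; rewrite Cb C0.
have s2 : abs_summable (fun k => c k * - (c k * a k)) (fun k => - (c k * (c k * b k))).
  apply: (sum2 (fun k => 2 * c k / (c k + beta))).
    move=> k; have := c1 k => ck; rewrite divr_ge0//=; [|by lra|by lra].
    by rewrite ler_pdivrMr; lra.
  move=> k; have s2 : 0 <= 2 * c k / (c k + beta).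
    by have := c1 k => ck; rewrite divr_ge0//; lra.
  rewrite mulrN !normrN [RHS]mulrDr -!nrm//; rewrite /a /b.
  have := cb k; have := c0 k; move: (c k) => C C0 Cb.
  by congr (_ + _); congr (Num.norm _); field; rewrite Cb C0.
pose phi := trig_sum a b.
pose p := trig_sum (fun k => c k * b k) (fun k => - (c k * a k)).
pose q := trig_sum (fun k => c k * - (c k * a k)) (fun k => - (c k * (c k * b k))).
have Lphi : L2 phi by exact: L2_trig_sum s0.
have Lp : L2 p by exact: L2_trig_sum s1.
have Lq : L2 q by exact: L2_trig_sum s2.
have wp : is_weak_derivative phi p := weak_derivative_trig_sum s0 s1.
have wq : is_weak_derivative p q := weak_derivative_trig_sum s1 s2.
have H1phi : H1 phi by split => //; exists p.
have [Lf wf] := wderivP H1phi.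
have pf : ae_eq mu setT p (wderiv phi) := weak_derivative_unique Lphi Lp Lf wp wf.
have H1f : H1 (wderiv phi).
  split => //; exists q; split => //.
  by have [_ mp _] := Lp; have [_ mf _] := Lf; exact: is_weak_derivative_ae pf wq.
have [[pL mL IL mL0] spec] := Lop_spectrum beta H1phi H1f.
have LE : ae_eq mu setT (Lop beta phi) psi.
  have [pp _ _] := Lpsi.
  apply: trig_coef_unique => //.
  - exact: L2_integrable.
  - by rewrite mL0 psi0.
  - move=> k; have [-> _] := spec k; rewrite (fsin_weak k Lphi wf) fcos_trig_sum//.
    rewrite /a -/(c k); have := cb k; have := c0 k; move: (c k) => C C0 Cb.
    by field; rewrite Cb C0.
  - move=> k; have [_ ->] := spec k; rewrite (fcos_weak k Lphi wf) fsin_trig_sum//.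
    rewrite /b -/(c k); have := cb k; have := c0 k; move: (c k) => C C0 Cb.
    by field; rewrite Cb C0.
exists phi; split => //; split => //; last by exists psi.
by split => //; exact: mean_trig_sum.
Qed.

(** By [Lop_spectrum] the equation forces the coefficients of the derivative of
    any preimage, so the choice made by [Linv] is immaterial; [parseval] then
    sums the inner product. *)
Lemma cvg_sigma2 beta psi : 0 < beta -> Hspace psi ->
  series (fun k => 2 * (1 / (1 + beta / k.+1%:R) * (fcos psi k ^+ 2 + fsin psi k ^+ 2)))
    @ \oo --> sigma2 beta psi.
Proof.
move=> b0 Hpsi; have [H1psi psi0] := Hpsi; have [Lpsi _] := H1psi.
have [Lg wg] := wderivP H1psi.
have [[[H1phi _] H1f _] Lphi] := @xgetPex _ (fun=> 0)
  [set phi | Ldom beta phi /\ ae_eq mu setT (Lop beta phi) psi] (Lop_surjective b0 Hpsi).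
rewrite -/(Linv beta psi) in H1phi H1f Lphi.
have [Lf0 wf0] := wderivP H1phi; have [Lf _] := H1f; have [Lf' wf'] := wderivP H1f.
have [[_ mL _ _] spec] := Lop_spectrum beta H1phi H1f.
have [_ mpsi _] := Lpsi.
have sf := abs_summable_harm (coef_weak_summable Lf Lf' wf').
have := parseval Lf (mean_weak wf0) sf Lg.
rewrite /sigma2 /Hdot; under [X in _ --> mean X]eq_fun do rewrite mulrC.
apply: eq_cvg_seq => n; apply: eq_bigr => k _.
have [] := spec k; rewrite (fcos_ae_eq k mL mpsi Lphi) (fsin_ae_eq k mL mpsi Lphi) => -> ->.
rewrite (fcos_weak k Lpsi wg) (fsin_weak k Lpsi wg).
have [] := spec k; rewrite (fcos_ae_eq k mL mpsi Lphi) (fsin_ae_eq k mL mpsi Lphi) => -> ->.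
have : 1 <= k.+1%:R :> R by rewrite ler1n.
move: (k.+1%:R : R) => c c1.
have c0 : c != 0 by rewrite gt_eqF//; lra.
have cb : c + beta != 0 by rewrite gt_eqF//; lra.
by field; rewrite cb c0.
Qed.

Lemma normc_fourier_coef psi k : L2 psi ->
  ComplexField.Normc.normc (fourier_coef psi k.+1%:Z) ^+ 2 = fcos psi k ^+ 2 + fsin psi k ^+ 2.
Proof.
move=> /L2_integrable Ipsi.
rewrite /fourier_coef /meanC /ComplexField.Normc.normc sqr_sqrtr ?addr_ge0 ?sqr_ge0//.
congr (_ ^+ 2 + _).
  by congr mean; apply/funext => x; rewrite /= cosN mul0r subr0.
rewrite -[RHS]sqrrN; congr (_ ^+ 2).
rewrite -[RHS]mulN1r /fsin -mean_scale; last exact: integrable_on_mul_sink.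
by congr mean; apply/funext => x; rewrite /= sinN mul0r addr0 mulN1r mulrN.
Qed.

End Resolvent.

Theorem lemma1p3 (R : realType) (beta : R) (beta_gt0 : 0 < beta)
    (psi : R -> R) (Hpsi : Hspace psi) :
  ((sigma2 beta psi)%:E =
   2%:E * \sum_(1 <= k <oo)
     (1 / (1 + beta / k%:R) * ComplexField.Normc.normc (fourier_coef psi k%:Z) ^+ 2)%:E)%E.
Proof.
have Lpsi : L2 psi by case: Hpsi => -[].
set t : nat -> R := fun k => 1 / (1 + beta / k%:R) *
  ComplexField.Normc.normc (fourier_coef psi k%:Z) ^+ 2.
have cv : (\sum_(1 <= k < n) t k) @[n --> \oo] --> sigma2 beta psi / 2.
  rewrite -cvg_shiftS /=.
  have := cvg_sigma2 beta_gt0 Hpsi => /(cvgM (cvg_cst (2^-1 : R))).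
  rewrite [2^-1 * _]mulrC; apply: eq_cvg_seq => n.
  rewrite big_add1/= /series/= big_distrr/=; apply: eq_bigr => k _.
  by rewrite /t normc_fourier_coef// mulKf.
have -> : (\sum_(1 <= k <oo) (t k)%:E = (sigma2 beta psi / 2)%:E)%E.
  apply/cvg_lim => //.
  under eq_fun do rewrite sumEFin.
  by apply: cvg_EFin => //; exact: nearW.
by rewrite -EFinM mulrC divfK.
Qed.
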